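(* There is no spherical tiling by $12$ edge congruent pentagons in which the edge lengths of the pentagon are $a,a,a,b,c$ with $a,b,c$ distinct.
   Context: A spherical tiling is given by a finite connected graph nicely embedded in $S^2$ (edges may be any reasonably nice curves, not necessarily great arcs) with all vertices of degree $\ge 3$; the tiles are the closures of the connected components of the complement. All tiles are pentagons (five edges) with no boundary points identified (each tile is enclosed by a simple closed curve). Each edge of the graph has a length. Two polygons are edge congruent if there is a correspondence between their edges that preserves adjacency of edges and preserves edge lengths. In a tiling by edge congruent pentagons, any two tiles are edge congruent. The edge lengths $a,a,a,b,c$ are given as an unordered combination; their cyclic arrangement in the pentagon is arbitrary. *)

(* Defs.v *)
(* Written with MathComp and MathComp-Analysis. *)
From HB Require Import structures.
From mathcomp Require Import all_boot all_order all_algebra all_fingroup.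
From mathcomp Require Import all_classical all_reals all_analysis.

Set Implicit Arguments.
Unset Strict Implicit.
Unset Printing Implicit Defensive.

Import Order.TTheory GRing.Theory Num.Theory.
Import numFieldNormedType.Exports.

Local Open Scope classical_set_scope.
Local Open Scope ring_scope.

Definition sphere (R : realType) : set 'rV[R]_3 :=
  [set x | \sum_(i < 3) x 0 i ^+ 2 = 1].

(* A finite multigraph drawn in space. Only the values of [curve e] on [0, 1]
   matter; [endpt e false] and [endpt e true] are its ends at 0 and at 1. *)
Record drawn_graph (R : realType) := DrawnGraph {
  vertex : finType;
  edge : finType;
  pos : vertex -> 'rV[R]_3;
  curve : edge -> R -> 'rV[R]_3;
  endpt : edge -> bool -> vertex
}.

Section Tilings.
Variable R : realType.

(* Near [x], the pair (sphere, [A]) looks like the pair (plane, line). Piecewise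
   smooth arcs have this property at their interior points; by the Schoenflies
   theorem so does every arc of the sphere. *)
Definition locally_flat (A : set 'rV[R]_3) (x : 'rV[R]_3) : Prop :=
  exists (O : set 'rV[R]_3) (f : 'rV[R]_3 -> R * R) (g : R * R -> 'rV[R]_3),
    let N := O `&` @sphere R in
    [/\ open O /\ N x,
        {within N, continuous f} /\ continuous g,
        forall y, N y -> g (f y) = y,
        forall p, N (g p) /\ f (g p) = p
      & forall y, N y -> (A y <-> (f y).2 = 0)].

Variable G : drawn_graph R.

Definition edge_set (e : edge G) : set 'rV[R]_3 := curve e @` `[0, 1].

Definition skeleton : set 'rV[R]_3 :=
  range (@pos R G) `|` \bigcup_(e in [set: edge G]) edge_set e.

(* Loops and multiple edges are not excluded here. The last clause is the
   requirement that the edges be reasonably nice curves. *)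
Record nicely_embedded : Prop := NicelyEmbedded {
  pos_sphere : forall v : vertex G, sphere (pos v);
  pos_inj : injective (@pos R G);
  curve_sphere : forall e : edge G, edge_set e `<=` @sphere R;
  curve_continuous : forall e : edge G, {within `[0, 1], continuous (curve e)};
  curve0 : forall e : edge G, curve e 0 = pos (endpt e false);
  curve1 : forall e : edge G, curve e 1 = pos (endpt e true);
  curve_disjoint : forall (e f : edge G) (s t : R), 0 < s < 1 -> 0 < t < 1 ->
    curve e s = curve f t -> e = f /\ s = t;
  curve_pos : forall (e : edge G) (s : R) (v : vertex G), 0 < s < 1 ->
    curve e s <> pos v;
  curve_flat : forall (e : edge G) (s : R), 0 < s < 1 ->
    locally_flat (edge_set e) (curve e s)
}.

Definition adjacent_vertices : rel (vertex G) :=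
  fun u v => [exists e : edge G, exists d : bool,
                (endpt e d == u) && (endpt e (~~ d) == v)].

Definition connected_graph : Prop :=
  forall u v : vertex G, connect adjacent_vertices u v.

(* A loop counts twice. *)
Definition degree (v : vertex G) : nat :=
  #|[pred h : edge G * bool | endpt h.1 h.2 == v]|.

Definition faces : set (set 'rV[R]_3) :=
  [set connected_component (@sphere R `\` skeleton) x
     | x in @sphere R `\` skeleton].

Definition tiles : set (set 'rV[R]_3) := closure @` faces.

Record spherical_tiling : Prop := SphericalTiling {
  tiling_embedded : nicely_embedded;
  tiling_connected : connected_graph;
  tiling_degree : forall v : vertex G, (3 <= degree v)%N
}.

(* [p] lists the edges around the face [U] in cyclic order, each traversed from
   [endpt _ d] to [endpt _ (~~ d)]. Since the five vertices are distinct, the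
   edges form a simple closed curve, so no boundary points are identified. *)
Definition pentagon_boundary (U : set 'rV[R]_3) (p : 'I_5 -> edge G * bool) :=
  [/\ forall i, endpt (p i).1 (~~ (p i).2)
                = endpt (p (ordS i)).1 (p (ordS i)).2,
      injective (fun i => endpt (p i).1 (p i).2)
    & closure U `\` U = \bigcup_(i in [set: 'I_5]) edge_set (p i).1].

Definition all_tiles_pentagons : Prop :=
  forall U, faces U -> exists p, pentagon_boundary U p.

Definition adjacent_edges (i j : 'I_5) : bool := (j == ordS i) || (i == ordS j).

(* Edge congruence of two pentagons whose successive edge lengths are [x] and
   [y]; [s] may be any rotation or reflection. *)
Definition edge_congruent (x y : 'I_5 -> R) : Prop :=
  exists s : {perm 'I_5},
    (forall i j, adjacent_edges (s i) (s j) = adjacent_edges i j) /\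
    (forall i, y (s i) = x i).

Variable len : edge G -> R.

Definition edge_congruent_tiles : Prop :=
  forall U V p q, faces U -> faces V ->
    pentagon_boundary U p -> pentagon_boundary V q ->
    edge_congruent (fun i => len (p i).1) (fun i => len (q i).1).

(* The unordered edge lengths, with multiplicity, of every tile are [s]. *)
Definition edge_combination (s : seq R) : Prop :=
  forall U p, faces U -> pentagon_boundary U p ->
    perm_eq [seq len (p i).1 | i <- enum 'I_5] s.

End Tilings.

(* Main.v *)
Require Import Defs.
From HB Require Import structures.
From mathcomp Require Import all_boot all_order all_algebra all_fingroup.
From mathcomp Require Import all_classical all_reals all_analysis.
From mathcomp Require Import ring lra zify.

Set Implicit Arguments.
Unset Strict Implicit.
Unset Printing Implicit Defensive.

Import Order.TTheory GRing.Theory Num.Theory.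
Import numFieldNormedType.Exports.
From mathcomp Require Import complex.

Local Open Scope classical_set_scope.
Local Open Scope ring_scope.
Local Open Scope complex_scope.

(* complex_scope is lost inside ring operations, where this would be Num.conj *)
Local Notation "x ^*" := (conjc x) : ring_scope.

(* Let F, E, V be the numbers of faces, edges and vertices. Counting corners and
   using local flatness (an edge touches at most two faces) gives 5 F <= 2 E, and
   3 V <= 2 E as the degrees are at least 3. If moreover E - V <= F - 2, then
   F = 12 forces E = 30, V = 20: all degrees are 3 and every edge lies on exactly
   two pentagons.

   The inequality E - V <= F - 2 replaces Euler's formula. In a stereographic
   coordinate phi centred in a face, an arc e from u to v admits on its
   complement a continuous square root s_e of (phi - u) / (phi - v), obtained by
   lifting t |-> (phi - e 0) / (phi - e t). If every vertex has even degree in a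
   set C of edges, the product of the s_e for e in C, divided by a suitable
   rational function, squares to 1, hence is a sign depending only on the face.
   If distinct C and C' gave the same signs, then s_e would extend across some
   edge e, to a square root of (phi - u) / (phi - v) around u, which is absurd.
   There are at least 2^(E - V + 1) sets C, and at most 2^(F - 1) families of
   signs as the sign is 1 on the face containing the pole.

   The rest is local. At a vertex of degree 3, the two other tiles at a corner
   share the third edge. If b and c are not adjacent in the tiles, let x be the
   edge with neighbours b and c: the third edges at its two ends have length a,
   so the tile across x has three consecutive edges a, a, a, which does not
   happen. If b and c are adjacent, the middle one x of the three consecutive
   edges a is also the middle one of the tile across x; at an end of x, with y
   the other edge of the first tile and z the third edge, z is in the same way
   the middle edge of the tile across y, hence also of the tile across x, which
   then has two middle edges. *)

(** * Real and imaginary parts of complex numbers *)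

Section ReIm.
Variable R : realType.
Implicit Types z w : R[i].

Lemma cReD z w : Re (z + w) = Re z + Re w. Proof. by case: z w => ? ? []. Qed.
Lemma cImD z w : Im (z + w) = Im z + Im w. Proof. by case: z w => ? ? []. Qed.
Lemma cReN z : Re (- z) = - Re z. Proof. by case: z. Qed.
Lemma cImN z : Im (- z) = - Im z. Proof. by case: z. Qed.
Lemma cReM z w : Re (z * w) = Re z * Re w - Im z * Im w.
Proof. by case: z w => ? ? []. Qed.
Lemma cImM z w : Im (z * w) = Re z * Im w + Im z * Re w.
Proof. by case: z w => ? ? []. Qed.
Lemma cReV z : Re z^-1 = Re z / (Re z ^+ 2 + Im z ^+ 2).
Proof. by case: z. Qed.
Lemma cImV z : Im z^-1 = - (Im z / (Re z ^+ 2 + Im z ^+ 2)).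
Proof. by case: z. Qed.
Lemma cReJ z : Re z^* = Re z. Proof. by case: z. Qed.
Lemma cImJ z : Im z^* = - Im z. Proof. by case: z. Qed.
Lemma cJM z w : (z * w)^* = z^* * w^*. Proof. exact: rmorphM. Qed.
Lemma cJB z w : (z - w)^* = z^* - w^*. Proof. exact: rmorphB. Qed.

End ReIm.

Lemma cvg_sqr (R : realType) (T : Type) (F : set_system T) (f : T -> R) (l : R) :
  Filter F -> f @ F --> l -> (fun x => f x ^+ 2) @ F --> l ^+ 2.
Proof.
by move=> FF fl; under eq_fun do rewrite expr2; rewrite expr2; apply: cvgM.
Qed.

(** * Limits of complex-valued functions *)

Section ComplexLimits.
Variables (R : realType) (T : Type) (F : set_system T).
Hypothesis FF : Filter F.
Implicit Types f g : T -> R[i].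

(** Stated through real and imaginary parts, so that only limits of real functions are involved. *)
Definition ccvg f (l : R[i]) : Prop :=
  (fun x => Re (f x)) @ F --> Re l /\ (fun x => Im (f x)) @ F --> Im l.

Lemma near_eq_ccvg f g l : (\forall x \near F, f x = g x) -> ccvg f l -> ccvg g l.
Proof.
move=> fg [fr fi]; split.
- by apply: cvg_trans fr; apply: near_eq_cvg; apply: filterS fg => x ->.
- by apply: cvg_trans fi; apply: near_eq_cvg; apply: filterS fg => x ->.
Qed.

Lemma ccvg_cst l : ccvg (fun=> l) l.
Proof. by split; apply: cvg_cst. Qed.

Lemma ccvgD f g l m : ccvg f l -> ccvg g m -> ccvg (fun x => f x + g x) (l + m).
Proof.
move=> [fr fi] [gr gi]; split.
- by rewrite cReD; under eq_fun do rewrite cReD; apply: cvgD.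
- by rewrite cImD; under eq_fun do rewrite cImD; apply: cvgD.
Qed.

Lemma ccvgN f l : ccvg f l -> ccvg (fun x => - f x) (- l).
Proof.
move=> [fr fi]; split.
- by rewrite cReN; under eq_fun do rewrite cReN; apply: cvgN.
- by rewrite cImN; under eq_fun do rewrite cImN; apply: cvgN.
Qed.

Lemma ccvgB f g l m : ccvg f l -> ccvg g m -> ccvg (fun x => f x - g x) (l - m).
Proof. by move=> fl gm; apply: ccvgD => //; apply: ccvgN. Qed.

Lemma ccvgM f g l m : ccvg f l -> ccvg g m -> ccvg (fun x => f x * g x) (l * m).
Proof.
move=> [fr fi] [gr gi]; split.
- by rewrite cReM; under eq_fun do rewrite cReM; apply: cvgB; apply: cvgM.
- by rewrite cImM; under eq_fun do rewrite cImM; apply: cvgD; apply: cvgM.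
Qed.

Lemma ccvg_conj f l : ccvg f l -> ccvg (fun x => (f x)^*) (l^*).
Proof.
move=> [fr fi]; split.
- by rewrite cReJ; under eq_fun do rewrite cReJ.
- by rewrite cImJ; under eq_fun do rewrite cImJ; apply: cvgN.
Qed.

Lemma ccvg_real (f : T -> R) (l : R) : f @ F --> l -> ccvg (fun x => (f x)%:C) l%:C.
Proof. by move=> fl; split => //=; apply: cvg_cst. Qed.

Lemma ccvgV f l : l != 0 -> ccvg f l -> ccvg (fun x => (f x)^-1) l^-1.
Proof.
move=> l0 [fr fi].
have ab0 : Re l ^+ 2 + Im l ^+ 2 != 0.
  by move: l0; case: (l) => a b; rewrite eq_complex /= paddr_eq0 ?sqr_ge0// !sqrf_eq0.
have dV : (fun x => (Re (f x) ^+ 2 + Im (f x) ^+ 2)^-1) @ F -->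
    (Re l ^+ 2 + Im l ^+ 2)^-1.
  by apply: cvgV => //; apply: cvgD; apply: cvg_sqr.
split.
- by rewrite cReV; under eq_fun do rewrite cReV; apply: cvgM.
- by rewrite cImV; under eq_fun do rewrite cImV; apply: cvgN; apply: cvgM.
Qed.

Lemma ccvgX f l n : ccvg f l -> ccvg (fun x => f x ^+ n) (l ^+ n).
Proof.
move=> fl; elim: n => [|n IH]; first exact: ccvg_cst.
by under [X in ccvg X]eq_fun do rewrite exprS; rewrite exprS; apply: ccvgM.
Qed.

Lemma ccvg_prod (I : finType) (P : pred I) (f : I -> T -> R[i]) (l : I -> R[i]) :
  (forall i, P i -> ccvg (f i) (l i)) ->
  ccvg (fun x => \prod_(i | P i) f i x) (\prod_(i | P i) l i).
Proof.
move=> fl.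
have H (s : seq I) : ccvg (fun x => \prod_(i <- s | P i) f i x)
    (\prod_(i <- s | P i) l i).
  elim: s => [|i s IH].
    by under [X in ccvg X]eq_fun do rewrite big_nil; rewrite big_nil; apply: ccvg_cst.
  under [X in ccvg X]eq_fun do rewrite big_cons; rewrite big_cons.
  by case: ifPn => // Pi; apply: ccvgM => //; apply: fl.
exact: H.
Qed.

End ComplexLimits.

Lemma Re_ccvg_gt0 (R : realType) (T : Type) (F : set_system T) (f : T -> R[i]) l :
  Filter F -> ccvg F f l -> 0 < Re l -> \forall x \near F, 0 < Re (f x).
Proof.
by move=> FF [fr _] l0; apply: cvgr_gt fr _ l0.
Qed.

(** * The principal square root on the right half plane *)

Section Sqrtc.
Variable R : realType.
Implicit Types w : R[i].

Lemma Re_sqrtc_ge0 w : 0 <= Re (sqrtc w).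
Proof. by case: w => a b /=; rewrite sqrtr_ge0. Qed.

Lemma sqr_Re w : Re (w ^+ 2) = Re w ^+ 2 - Im w ^+ 2.
Proof. by case: w => a b; rewrite !expr2. Qed.

Lemma sqr_Im w : Im (w ^+ 2) = 2 * (Re w * Im w).
Proof. case: w => a b; rewrite expr2 /=; ring. Qed.

(** Re w is the difference of the squares of the real and imaginary parts of the root. *)
Lemma Re_sqrtc_gt w : 0 < Re w -> `|Im (sqrtc w)| < Re (sqrtc w).
Proof.
move=> w0; have := w0; rewrite -{1}(sqr_sqrtc w) sqr_Re subr_gt0 => h.
by rewrite -(@ltr_pXn2r _ 2) ?nnegrE ?Re_sqrtc_ge0// real_normK// num_real.
Qed.

(** Both sides have the same square. By [Re_sqrtc_gt] the roots lie in the sector |Im| < Re, so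
    their product has positive real part, which excludes the opposite sign. *)
Lemma sqrtcM w w' : 0 < Re w -> 0 < Re w' -> 0 < Re (w * w') ->
  sqrtc w * sqrtc w' = sqrtc (w * w').
Proof.
move=> w0 w'0 ww'0.
have /eqP : (sqrtc w * sqrtc w') ^+ 2 = (sqrtc (w * w')) ^+ 2.
  by rewrite exprMn !sqr_sqrtc.
rewrite eqf_sqr => /orP[/eqP //|/eqP h].
have := le_lt_trans (normr_ge0 _) (Re_sqrtc_gt ww'0).
have : 0 < Re (sqrtc w * sqrtc w').
  move: (Re_sqrtc_gt w0) (Re_sqrtc_gt w'0).
  case: (sqrtc w) (sqrtc w') => [a b] [c d] /=.
  move=> hb hd; rewrite subr_gt0; apply: le_lt_trans (ler_norm _) _.
  by rewrite normrM ltr_pM.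
rewrite h; case: (sqrtc (w * w')) => [a b] /=.
by rewrite oppr_gt0 => /lt_trans h1 /h1; rewrite ltxx.
Qed.

Lemma ccvg_sqrtc (T : Type) (F : set_system T) (f : T -> R[i]) l :
  Filter F -> 0 < Re l -> ccvg F f l -> ccvg F (fun x => sqrtc (f x)) (sqrtc l).
Proof.
move=> FF l0 fl; have [fr fi] := fl.
have ReE w : Re (sqrtc w) = Num.sqrt ((Num.sqrt (Re w ^+ 2 + Im w ^+ 2) + Re w) / 2).
  by case: w.
have cr : (fun x => Re (sqrtc (f x))) @ F --> Re (sqrtc l).
  rewrite ReE; under eq_fun do rewrite ReE.
  apply: (continuous_cvg _ (@sqrt_continuous R _)).
  apply: cvgM; last exact: cvg_cst.
  apply: cvgD => //.
  apply: (continuous_cvg _ (@sqrt_continuous R _)).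
  by apply: cvgD; apply: cvg_sqr.
split => //.
(* The imaginary part is recovered from Im w = 2 Re (sqrtc w) Im (sqrtc w). *)
have ImE w : 0 < Re w -> Im (sqrtc w) = Im w / (2 * Re (sqrtc w)).
  move=> w0; rewrite -{2}(sqr_sqrtc w) sqr_Im.
  have : Re (sqrtc w) != 0 by rewrite gt_eqF// (le_lt_trans (normr_ge0 _) (Re_sqrtc_gt w0)).
  by move=> h; field.
rewrite ImE//.
apply: cvg_trans (_ : (fun x => Im (f x) / (2 * Re (sqrtc (f x)))) @ F `=>` _).
  apply: near_eq_cvg; near=> x; rewrite ImE//.
  near: x; exact: Re_ccvg_gt0 fl l0.
apply: cvgM => //; apply: cvgV; last by apply: cvgM => //; apply: cvg_cst.
by rewrite mulf_neq0// gt_eqF// (le_lt_trans (normr_ge0 _) (Re_sqrtc_gt l0)).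
Unshelve. all: by end_near. Qed.

End Sqrtc.

Lemma connected_sgr (R : realType) (T : topologicalType) (U : set T) (f : T -> R) :
  connected U -> {within U, continuous f} -> (forall x, U x -> f x != 0) ->
  forall x y, U x -> U y -> 0 < f x -> 0 < f y.
Proof.
move=> cU cf f0 x y Ux Uy fx; rewrite ltNge; apply/negP => fy.
have /connected_intervalP I := connected_continuous_connected cU cf.
have [z Uz fz] : (f @` U) 0.
  by apply: (I (f y) (f x)); [exists y|exists x|rewrite fy (ltW fx)].
by have := f0 z Uz; rewrite fz eqxx.
Qed.

(** * Square roots of rational functions off an arc *)

Section SphereForm.
Variables (R : realType) (T : topologicalType) (S : set T).
Variables (X : T -> R[i]) (W : T -> R).
Hypothesis XW : forall z, S z -> X z * (X z)^* = (1 + W z)%:C * (1 - W z)%:C.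
Hypothesis cX : forall z, S z -> ccvg (within S (nbhs z)) X (X z).
Hypothesis cW : forall z, S z -> W @ within S (nbhs z) --> W z.

(* With phi = X / (1 - W), this is (1 - W) (phi z - P) (phi z - Q)^*, written so
   that it makes sense at the pole W = 1. *)
Definition sform z (P Q : R[i]) : R[i] :=
  (1 + W z)%:C - X z * Q^* - P * (X z)^* + (1 - W z)%:C * P * Q^*.

(* (phi z - P) / (phi z - Q) *)
Definition sratio z P Q : R[i] := sform z P Q / sform z Q Q.

(** The difference of the two sides is a multiple of the equation [XW] of the sphere; no division by
    1 - W occurs, so the pole is included. *)
Lemma sformM z P Q Q' U : S z ->
  sform z P Q * sform z Q' U = sform z Q' Q * sform z P U.
Proof.
move=> /XW h; apply/eqP; rewrite -subr_eq0; apply/eqP; rewrite /sform.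
transitivity ((X z * (X z)^* - (1 + W z)%:C * (1 - W z)%:C) *
  ((P - Q') * (U^* - Q^*))); first by ring.
by rewrite h subrr mul0r.
Qed.

Lemma sform_affine z p Q Q' : S z -> W z != 1 -> X z = p * (1 - W z)%:C ->
  sform z Q Q' = (1 - W z)%:C * ((p - Q) * (p - Q')^*).
Proof.
move=> /XW + Wz Xz; rewrite /sform Xz; set m := (1 - W _)%:C.
have m0 : m != 0 by rewrite eq_complex /= eqxx andbT subr_eq0 eq_sym.
have mJ : m^* = m by rewrite conjc_real.
rewrite cJM mJ => h.
have -> : (1 + W z)%:C = p * p^* * m.
  by apply: (mulIf m0); rewrite -h; ring.
by rewrite cJB; ring.
Qed.

Lemma sratioxx z P : sform z P P != 0 -> sratio z P P = 1.
Proof. by move=> h; rewrite /sratio divff. Qed.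

Lemma sratioM z P Q U : S z -> sform z Q Q != 0 -> sform z U U != 0 ->
  sratio z P Q * sratio z Q U = sratio z P U.
Proof.
move=> Sz q u; rewrite /sratio mulrACA sformM// mulrACA divff// mul1r//.
Qed.

Lemma sratio_neq0 z P Q : S z -> sform z P P != 0 -> sform z Q Q != 0 ->
  sratio z P Q != 0.
Proof.
move=> Sz p q; apply/eqP => h; have := sratioM P Sz q p.
by rewrite h mul0r sratioxx// => /eqP; rewrite eq_sym oner_eq0.
Qed.

(** The point and both parameters move along one filter: [fine_mesh_near] varies all three at once,
    other uses keep the parameters fixed. *)
Lemma ccvg_sform (I : Type) (F : set_system I) (zf : I -> T) (Pf Qf : I -> R[i])
    z P Q :
  Filter F -> S z -> zf @ F --> within S (nbhs z) ->
  ccvg F Pf P -> ccvg F Qf Q ->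
  ccvg F (fun i => sform (zf i) (Pf i) (Qf i)) (sform z P Q).
Proof.
move=> FF Sz zfz fP fQ.
have fX : ccvg F (fun i => X (zf i)) (X z).
  by have [xr xi] := cX Sz; split; [exact: (cvg_comp _ _ zfz xr)|exact: (cvg_comp _ _ zfz xi)].
have fW : (fun i => W (zf i)) @ F --> W z.
  exact: (cvg_comp _ _ zfz (cW Sz)).
apply: ccvgD.
  apply: ccvgB.
    apply: ccvgB; first by apply: ccvg_real; apply: cvgD => //; apply: cvg_cst.
    by apply: ccvgM => //; apply: ccvg_conj.
  by apply: ccvgM => //; apply: ccvg_conj.
apply: ccvgM; last exact: ccvg_conj.
apply: ccvgM => //; apply: ccvg_real.
by apply: cvgB => //; apply: cvg_cst.
Qed.

Lemma ccvg_sratio (I : Type) (F : set_system I) (zf : I -> T) (Pf Qf : I -> R[i])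
    z P Q :
  Filter F -> S z -> zf @ F --> within S (nbhs z) ->
  ccvg F Pf P -> ccvg F Qf Q -> sform z Q Q != 0 ->
  ccvg F (fun i => sratio (zf i) (Pf i) (Qf i)) (sratio z P Q).
Proof.
move=> FF Sz zfz fP fQ h; apply: ccvgM; first exact: ccvg_sform.
by apply: ccvgV => //; apply: ccvg_sform.
Qed.

(** * Lifting along an arc through the squaring map *)

Section Arc.
Variable E : R -> R[i].
Hypothesis cE : forall t : R, ccvg (nbhs t) E (E t).

(** With equal parameters the form is (1 - W) |phi z - E t|^2, or 2 at the pole, so it vanishes
    exactly when phi z = E t. *)
Definition off_arc z := forall t : R, 0 <= t <= 1 -> sform z (E t) (E t) != 0.

(** On steps of length at most d the ratio stays in the half plane where the principal root is
    continuous. *)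
Definition fine_mesh z (d : R) := forall t t' : R, 0 <= t <= 1 -> 0 <= t' <= 1 ->
  `|t - t'| <= d -> 0 < Re (sratio z (E t) (E t')).

(** The ratio is 1 on the diagonal t = t', hence has positive real part near it, jointly in z.
    Compactness of [0, 1], in its near-covering form, makes d uniform in t and in z near z0. *)
Lemma fine_mesh_near z0 : S z0 -> off_arc z0 ->
  exists2 d : R, 0 < d & \forall z \near within S (nbhs z0), fine_mesh z d.
Proof.
move=> Sz0 oz0.
pose F := within S (nbhs z0).
have FF : Filter F by apply: within_filter.
pose G : set_system (T * R) := filter_prod F (0 : R)^'+.
have FG : Filter G by apply: filter_prod_filter.
pose P (i : T * R) (t : R) := forall t' : R, 0 <= t' <= 1 -> `|t - t'| <= i.2 ->
  0 < Re (sratio i.1 (E t) (E t')).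
have /compact_near_coveringP nc := @segment_compact R 0 1.
have /(nc _ G P) : forall x : R, `[0, 1]%classic x ->
    \forall x' \near x & i \near G, P i x'.
  move=> t0; rewrite /= in_itv /= => t01.
  have cv : ccvg (filter_prod F (filter_prod (nbhs t0) (nbhs t0)))
     (fun i => sratio i.1 (E i.2.1) (E i.2.2)) (sratio z0 (E t0) (E t0)).
    have [er ei] := cE t0.
    apply: ccvg_sratio => //.
    - exact: cvg_fst.
    - have c : (fun i : T * (R * R) => i.2.1) @
        filter_prod F (filter_prod (nbhs t0) (nbhs t0)) --> t0.
        exact: (cvg_comp _ _ cvg_snd cvg_fst).
      by split; [exact: (cvg_comp _ _ c er)|exact: (cvg_comp _ _ c ei)].
    - have c : (fun i : T * (R * R) => i.2.2) @
        filter_prod F (filter_prod (nbhs t0) (nbhs t0)) --> t0.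
        exact: (cvg_comp _ _ cvg_snd cvg_snd).
      by split; [exact: (cvg_comp _ _ c er)|exact: (cvg_comp _ _ c ei)].
    - exact: oz0.
  have [|[A B]] := Re_ccvg_gt0 _ cv; first by rewrite sratioxx ?oz0//= ltr01.
  move=> /= [FA [[B1 B2] /= [B1t B2t] sB]] sAB.
  have /nbhs_ballP[r /= r0 rB] : nbhs t0 (B1 `&` B2) by exact: filterI.
  (* Half of the radius is kept for the distance from t to t'. *)
  exists (ball t0 (r / 2), A `*` [set d | d < r / 2]) => /=.
    split; first by apply: nbhsx_ballx; rewrite divr_gt0.
    exists (A, [set d | d < r / 2]) => //=; split => //.
    by apply: nbhs_right_lt; rewrite divr_gt0.
  case=> t [z d] /= [tr [Az dr]] t' t'01 /= tt'.
  apply: (sAB (z, (t, t'))); split => //=; apply: sB; split => /=.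
    apply: (rB _ _).1; rewrite /ball /=; apply: lt_trans tr _.
    by rewrite ltr_pdivrMr// ltr_pMr// ltr1n.
  apply: (rB _ _).2; rewrite /ball /= (splitr r).
  rewrite -(subrKA t); apply: le_lt_trans (ler_normD _ _) _.
  by apply: ltrD => //; apply: le_lt_trans tt' _.
case=> -[A B] /= [FA FB] sAB.
have [d [Bd d0]] : exists d, B d /\ 0 < d.
  apply: (@filter_ex _ (0:R)^'+); apply: filterI => //.
  exact: nbhs_right_gt.
exists d => //; apply: filterS FA => z Az t t' t01 t'01 tt'.
by apply: (sAB (z, d)) => //=; rewrite in_itv.
Qed.

Lemma off_arc_near z : S z -> off_arc z ->
  \forall x \near within S (nbhs z), off_arc x.
Proof.
move=> Sz oz; have [d d0 nd] := fine_mesh_near Sz oz.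
apply: filterS nd => x fx t t01; apply/negP => /eqP h.
have := fx t t t01 t01; rewrite subrr normr0 (ltW d0) => /(_ isT).
by rewrite /sratio h mul0r ltxx.
Qed.

(** The product of the principal roots over the 2^k equal steps from a to b. *)
Fixpoint dyadic_sqrt k z (a b : R) : R[i] :=
  if k is k'.+1 then
    dyadic_sqrt k' z a ((a + b) / 2) * dyadic_sqrt k' z ((a + b) / 2) b
  else sqrtc (sratio z (E a) (E b)).

Lemma dyadic_sqrt_sqr k z a b : S z -> off_arc z -> 0 <= a -> a <= b -> b <= 1 ->
  dyadic_sqrt k z a b ^+ 2 = sratio z (E a) (E b).
Proof.
move=> Sz oz; elim: k a b => [|k IH] a b a0 ab b1 /=; first exact: sqr_sqrtc.
by rewrite exprMn !IH ?sratioM//; try apply: oz; lra.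
Qed.

(** Once the steps are shorter than the mesh, bisecting one of them does not change its factor, by
    [sqrtcM]. *)
Lemma dyadic_sqrt_stable k z d a b : S z -> off_arc z -> fine_mesh z d ->
  0 <= a -> a <= b -> b <= 1 -> (b - a) / 2 ^+ k <= d ->
  dyadic_sqrt k.+1 z a b = dyadic_sqrt k z a b.
Proof.
move=> Sz oz fz; elim: k a b => [|k IH] a b a0 ab b1.
  rewrite expr0 divr1 => bad /=.
  have m : sratio z (E a) (E ((a + b) / 2)) * sratio z (E ((a + b) / 2)) (E b) =
      sratio z (E a) (E b).
    by apply: sratioM => //; apply: oz; lra.
  by rewrite sqrtcM ?m//; apply: fz; try lra; rewrite distrC ger0_norm; lra.
move=> h; have e : (b - a) / 2 ^+ k.+1 = (b - a) / 2 / 2 ^+ k.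
  by rewrite exprS invfM mulrA.
rewrite e in h.
have h1 : ((a + b) / 2 - a) / 2 ^+ k <= d.
  by have -> : (a + b) / 2 - a = (b - a) / 2 by lra.
have h2 : (b - (a + b) / 2) / 2 ^+ k <= d.
  by have -> : b - (a + b) / 2 = (b - a) / 2 by lra.
have -> : dyadic_sqrt k.+2 z a b =
  dyadic_sqrt k.+1 z a ((a + b) / 2) * dyadic_sqrt k.+1 z ((a + b) / 2) b by [].
by congr (_ * _); apply: IH => //; lra.
Qed.

Lemma dyadic_sqrt_cvg k z d a b : S z -> off_arc z -> fine_mesh z d ->
  0 <= a -> a <= b -> b <= 1 -> (b - a) / 2 ^+ k <= d ->
  ccvg (within S (nbhs z)) (fun x => dyadic_sqrt k x a b) (dyadic_sqrt k z a b).
Proof.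
move=> Sz oz fz; elim: k a b => [|k IH] a b a0 ab b1.
  rewrite expr0 divr1 => bad /=; apply: ccvg_sqrtc.
    by apply: fz; try lra; rewrite distrC ger0_norm; lra.
  apply: (ccvg_sratio (zf := fun x => x) (Pf := fun=> E a) (Qf := fun=> E b)) => //.
  - exact: ccvg_cst.
  - exact: ccvg_cst.
  - by apply: oz; lra.
rewrite exprS invfM mulrA => h; by apply: ccvgM; apply: IH; lra.
Qed.

(* For z off the arc, the path t |-> (phi z - E 0) / (phi z - E t) avoids 0 and
   starts at 1; lifting it through the squaring map from 1 to t = 1 defines the
   required branch. *)
Lemma arc_sqrt : exists s : T -> R[i], forall z, S z -> off_arc z ->
  [/\ s z ^+ 2 = sratio z (E 0) (E 1), ccvg (within S (nbhs z)) s (s z)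
    & (forall t t', sratio z (E t) (E t') = 1) -> s z = 1].
Proof.
(* Off the arc the dyadic products are eventually constant in the level, and [s z] is that constant;
   the default 0 is not taken there. *)
pose st z w := exists k, forall j, (k <= j)%N -> dyadic_sqrt j z 0 1 = w.
pose s z := xget 0 (st z).
have stE z d k : S z -> off_arc z -> fine_mesh z d -> 1 / 2 ^+ k <= d ->
    s z = dyadic_sqrt k z 0 1.
  move=> Sz oz fz kd.
  have stk j : (k <= j)%N -> dyadic_sqrt j z 0 1 = dyadic_sqrt k z 0 1.
    move=> /subnK <-; elim: (j - k)%N => // i <-.
    rewrite addSn (dyadic_sqrt_stable Sz oz fz)// subr0.
    apply: le_trans kd; rewrite !div1r lef_pV2 ?posrE ?exprn_gt0//.
    by rewrite ler_eXn2l ?ltr1n// leq_addl.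
  rewrite /s; apply: xget_unique; first by exists k.
  move=> w [j jw]; rewrite -(jw (maxn j k)) ?leq_maxl//.
  by rewrite stk// leq_maxr.
have ex_k (d : R) : 0 < d -> exists k, 1 / 2 ^+ k <= d.
  move=> d0; exists (Num.truncn d^-1).+1.
  rewrite div1r -[leRHS]invrK lef_pV2 ?posrE ?exprn_gt0 ?invr_gt0//.
  apply: le_trans (ltW (truncnS_gt _)) _.
  by rewrite -natrX ler_nat ltnW// ltn_expl.
exists s => z Sz oz.
have [d d0 nd] := fine_mesh_near Sz oz.
have [k kd] := ex_k _ d0.
have fz : fine_mesh z d.
  by move: nd; rewrite near_withinE => /nbhs_singleton; apply.
split.
- by rewrite (stE z d k)// dyadic_sqrt_sqr.
- have no := off_arc_near Sz oz.
  rewrite (stE z d k)//; 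
  apply: near_eq_ccvg (dyadic_sqrt_cvg Sz oz fz _ _ _ _) => //;
    last by rewrite subr0; exact: kd.
  have nS : \forall x \near within S (nbhs z), S x by exact: withinT.
  by apply: filterS3 nd no nS => x fx ox Sx; rewrite (stE x d k).
- move=> h1; rewrite (stE z d k)//.
  by elim: (k) 0 1 => [|j IH] a b /=; rewrite ?h1 ?sqrtc1// !IH mulr1.
Qed.

End Arc.
End SphereForm.

(** * Signs of even edge sets *)

Section EdgeSets.
Variables (V Ed : finType) (ept : Ed -> bool -> V).

Definition edge_degree (C : {set Ed}) v : nat :=
  (\sum_(e in C) ((ept e false == v) + (ept e true == v)))%N.

(** These sets form the cycle space of the graph over the field with two elements. *)
Definition even_edges (C : {set Ed}) := [forall v, ~~ odd (edge_degree C v)].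

End EdgeSets.

(** Edge sets are sorted by their odd vertices other than v0, which leaves 2^(V - 1) classes.
    Symmetric difference with a fixed member embeds each nonempty class into the even sets: the
    parity at v0 is forced, as the degrees have an even sum. *)
Lemma even_edges_count (V Ed : finType) (ept : Ed -> bool -> V) (v0 : V) :
  (2 ^ #|Ed| <= 2 ^ #|V|.-1 * #|[set C | even_edges ept C]|)%N.
Proof.
pose d (e : Ed) v : nat := ((ept e false == v) + (ept e true == v))%N.
pose sdiff (C D : {set Ed}) := (C :\: D) :|: (D :\: C).
have deg_sdiff C D v : odd (edge_degree ept (sdiff C D) v) =
    odd (edge_degree ept C v) (+) odd (edge_degree ept D v).
  have -> : edge_degree ept (sdiff C D) v =
      (\sum_(e in C :\: D) d e v + \sum_(e in D :\: C) d e v)%N.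
    rewrite /edge_degree (big_setID C)/=; congr (_ + _)%N; apply: eq_bigl => e.
      by rewrite !inE; case: (e \in C); case: (e \in D).
    by rewrite !inE; case: (e \in C); case: (e \in D).
  rewrite /edge_degree [in RHS](big_setID D)/= [X in _ (+) odd X](big_setID C)/=.
  rewrite [D :&: C]finset.setIC !oddD -/(d _ _).
  by case: (odd _); case: (odd _); case: (odd _).
have sum_deg C : ~~ odd (\sum_v edge_degree ept C v)%N.
  rewrite /edge_degree exchange_big /=.
  have -> : (\sum_(e in C) \sum_v ((ept e false == v) + (ept e true == v)) =
      \sum_(e in C) (1 + 1))%N.
    apply: eq_bigr => e _; rewrite big_split /=; congr (_ + _)%N.
      by rewrite (bigD1 (ept e false))//= eqxx big1// => v /negPf; rewrite eq_sym => ->.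
    by rewrite (bigD1 (ept e true))//= eqxx big1// => v /negPf; rewrite eq_sym => ->.
  by rewrite sum_nat_const muln2 odd_double.
have even_off C : (forall v, v != v0 -> ~~ odd (edge_degree ept C v)) ->
    even_edges ept C.
  move=> h; apply/forallP => v; have [->|/h//] := eqVneq v v0.
  have := sum_deg C; rewrite (bigD1 v0)//= oddD.
  have -> : odd (\sum_(v | v != v0) edge_degree ept C v) = false.
    apply: (big_ind (fun k => odd k = false)) => //.
      by move=> x y hx hy; rewrite oddD hx hy.
    by move=> w /h/negPf.
  by rewrite addbF.
pose bd (C : {set Ed}) := [set v | (v != v0) && odd (edge_degree ept C v)]%SET.
have -> : (2 ^ #|V|.-1 = #|powerset [set~ v0]|)%N by rewrite card_powerset cardsC1.
have -> : (2 ^ #|Ed| = #|{set Ed}|)%N.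
  rewrite -(cardsT Ed) -card_powerset; apply: eq_card => C.
  by rewrite powersetE finset.subsetT.
rewrite -[X in (X <= _)%N]sum1_card (partition_big bd (mem (powerset [set~ v0])))/=; last first.
  by move=> C _; rewrite powersetE; apply/fintype.subsetP => v; rewrite !inE => /andP[].
rewrite -sum_nat_const; apply: leq_sum => D _.
rewrite sum1_card; have [C0 /eqP C0D|none] := pickP (fun C => bd C == D); last first.
  by rewrite eq_card0// => C; have := none C; rewrite unfold_in.
rewrite -(card_in_imset (f := sdiff C0)) => [|C C' _ _ h]; last first.
  apply/finset.setP => e; have /finset.setP/(_ e) := h; rewrite !inE.
  by case: (e \in C0); case: (e \in C); case: (e \in C').
apply: subset_leq_card; apply/fintype.subsetP => _ /imsetP[C CD ->].
rewrite inE; apply: even_off => v vv0; rewrite deg_sdiff.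
have /finset.setP/(_ v) : bd C = bd C0 by rewrite C0D; apply/eqP.
by rewrite !inE vv0 /= => ->; rewrite addbb.
Qed.

(** * Branches attached to a system of arcs, and their signs *)

Section ArcSystem.
Variables (R : realType) (T : topologicalType) (S : set T).
Variables (X : T -> R[i]) (W : T -> R).
Hypothesis XW : forall z, S z -> X z * (X z)^* = (1 + W z)%:C * (1 - W z)%:C.
Hypothesis cX : forall z, S z -> ccvg (within S (nbhs z)) X (X z).
Hypothesis cW : forall z, S z -> W @ within S (nbhs z) --> W z.
Variables (V Ed : finType) (ept : Ed -> bool -> V) (P : V -> R[i]) (v0 : V).
Variable E : Ed -> R -> R[i].
Hypothesis cE : forall e (t : R), ccvg (nbhs t) (E e) (E e t).
Hypothesis E0 : forall e, E e 0 = P (ept e false).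
Hypothesis E1 : forall e, E e 1 = P (ept e true).
Variable n : T.
Hypotheses (Sn : S n) (Xn : X n = 0) (Wn : W n = 1).

Local Notation sf := (sform X W).
Local Notation sr := (sratio X W).
Local Notation off e := (off_arc X W (E e)).
Local Notation edge_degree := (edge_degree ept).
Local Notation even_edges := (even_edges ept).

Definition off_vertices z := forall v, sf z (P v) (P v) != 0.
Definition off_graph z := [/\ S z, off_vertices z & forall e, off e z].

(** This is (phi - P v) / (phi - P v0), the base vertex [v0] serving to make it finite, with value
    1, at the pole. *)
Definition vratio v z : R[i] := sr z (P v) (P v0).

Lemma vratio_neq0 v z : S z -> off_vertices z -> vratio v z != 0.
Proof. by move=> Sz oz; apply: (sratio_neq0 XW); [|exact: oz|exact: oz]. Qed.

Lemma ccvg_vratio v z : S z -> off_vertices z ->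
  ccvg (within S (nbhs z)) (vratio v) (vratio v z).
Proof.
move=> Sz oz.
apply: (ccvg_sratio cX cW (zf := fun x => x) (Pf := fun=> P v) (Qf := fun=> P v0)) => //.
- exact: ccvg_cst.
- exact: ccvg_cst.
Qed.

Lemma off_vertices_near z : S z -> off_vertices z ->
  \forall x \near within S (nbhs z), off_vertices x.
Proof.
move=> Sz oz; apply: filter_forall => v.
(* A vertex is treated as a constant arc. *)
have cst (t : R) : ccvg (nbhs t) (fun=> P v) (P v) by exact: ccvg_cst.
have := off_arc_near cX cW cst Sz (fun _ _ => oz v).
by apply: filterS => x /(_ 0); apply; rewrite lexx ler01.
Qed.

Lemma sform_pole Q Q' : sf n Q Q' = 2%:R.
Proof.
rewrite /sform Xn Wn rmorph0 mul0r mulr0 !subr0 subrr !mul0r addr0.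
by rewrite rmorphD rmorph1.
Qed.

Lemma sratio_pole Q Q' : sr n Q Q' = 1.
Proof. by rewrite /sratio !sform_pole divff// pnatr_eq0. Qed.

(** Multiplying the root from [arc_sqrt] by [vratio] at the end of the arc makes its square
    symmetric in the two ends, so that squares of products over edges depend on vertex degrees
    only. *)
Lemma branch_exists : exists s : Ed -> T -> R[i], forall e z,
  S z -> off_vertices z -> off e z ->
  [/\ s e z ^+ 2 = vratio (ept e false) z * vratio (ept e true) z,
      ccvg (within S (nbhs z)) (s e) (s e z) & z = n -> s e z = 1].
Proof.
have /choice[s Hs] := fun e => arc_sqrt XW cX cW (cE e).
exists (fun e z => s e z * vratio (ept e true) z) => e z Sz ovz oez.
have [s2 sc s1] := Hs e z Sz oez; split.
- rewrite exprMn s2 E0 E1 expr2 mulrA; congr (_ * _).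
  by rewrite /vratio (sratioM XW).
- by apply: ccvgM => //; apply: ccvg_vratio.
- by move=> ?; subst z; rewrite s1 ?mul1r => [|t t']; exact: sratio_pole.
Qed.

Section Signs.
Variable s : Ed -> T -> R[i].
Hypothesis Hs : forall e z, S z -> off_vertices z -> off e z ->
  [/\ s e z ^+ 2 = vratio (ept e false) z * vratio (ept e true) z,
      ccvg (within S (nbhs z)) (s e) (s e z) & z = n -> s e z = 1].

Definition edge_prod (C : {set Ed}) z := \prod_(e in C) s e z.
(** For an even set the halves are exact, and this is a rational square root of the square of
    [edge_prod]. *)
Definition vertex_prod (C : {set Ed}) z :=
  \prod_v vratio v z ^+ (edge_degree C v)./2.
Definition cycle_sign (C : {set Ed}) z := edge_prod C z / vertex_prod C z.

Lemma prod_vratio_degree (C : {set Ed}) z :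
  \prod_(e in C) (vratio (ept e false) z * vratio (ept e true) z) =
  \prod_v vratio v z ^+ edge_degree C v.
Proof.
rewrite /edge_degree.
under [RHS]eq_bigr do rewrite expr_sum.
rewrite exchange_big /=; apply: eq_bigr => e _.
under eq_bigr do rewrite exprD.
rewrite big_split /=; congr (_ * _).
  rewrite (bigD1 (ept e false))//= eqxx expr1 big1 ?mulr1// => v /negPf h.
  by rewrite eq_sym h.
rewrite (bigD1 (ept e true))//= eqxx expr1 big1 ?mulr1// => v /negPf h.
by rewrite eq_sym h.
Qed.

Lemma edge_prod_sqr (C : {set Ed}) z : S z -> off_vertices z -> (forall e, e \in C -> off e z) ->
  edge_prod C z ^+ 2 = \prod_v vratio v z ^+ edge_degree C v.
Proof.
move=> Sz ovz oez; rewrite -prod_vratio_degree /edge_prod -prodrXl.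
by apply: eq_bigr => e eC; have [] := Hs Sz ovz (oez e eC).
Qed.

Lemma vertex_prod_sqr (C : {set Ed}) z : even_edges C ->
  vertex_prod C z ^+ 2 = \prod_v vratio v z ^+ edge_degree C v.
Proof.
move=> /forallP eC; rewrite /vertex_prod -prodrXl; apply: eq_bigr => v _.
by rewrite -exprM muln2 even_halfK.
Qed.

Lemma vertex_prod_neq0 (C : {set Ed}) z : S z -> off_vertices z -> vertex_prod C z != 0.
Proof.
by move=> Sz oz; apply/prodf_neq0 => v _; apply/expf_neq0/vratio_neq0.
Qed.

Lemma edge_prod_neq0 (C : {set Ed}) z : S z -> off_vertices z -> (forall e, e \in C -> off e z) ->
  edge_prod C z != 0.
Proof.
move=> Sz oz oez; rewrite -sqrf_eq0 edge_prod_sqr//.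
by apply/prodf_neq0 => v _; apply/expf_neq0/vratio_neq0.
Qed.

Lemma ccvg_vertex_prod (C : {set Ed}) z : S z -> off_vertices z ->
  ccvg (within S (nbhs z)) (vertex_prod C) (vertex_prod C z).
Proof.
by move=> Sz oz; apply: ccvg_prod => v _; apply/ccvgX/ccvg_vratio.
Qed.

Lemma ccvg_edge_prod (C : {set Ed}) z : S z -> off_vertices z -> (forall e, e \in C -> off e z) ->
  ccvg (within S (nbhs z)) (edge_prod C) (edge_prod C z).
Proof.
by move=> Sz oz oez; apply: ccvg_prod => e eC; have [] := Hs Sz oz (oez e eC).
Qed.

Lemma cycle_sign_sqr (C : {set Ed}) z : even_edges C -> off_graph z -> cycle_sign C z ^+ 2 = 1.
Proof.
move=> eC [Sz oz oez]; rewrite exprMn exprVn edge_prod_sqr// vertex_prod_sqr//.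
by rewrite divff// -vertex_prod_sqr// expf_neq0// vertex_prod_neq0.
Qed.

Lemma ccvg_cycle_sign (C : {set Ed}) z : off_graph z ->
  ccvg (within S (nbhs z)) (cycle_sign C) (cycle_sign C z).
Proof.
move=> [Sz oz oez]; apply: ccvgM; first exact: ccvg_edge_prod.
by apply: ccvgV; [exact: vertex_prod_neq0|exact: ccvg_vertex_prod].
Qed.

Lemma cycle_sign_pole (C : {set Ed}) : off_graph n -> cycle_sign C n = 1.
Proof.
move=> [_ on oen]; rewrite /cycle_sign /edge_prod /vertex_prod.
rewrite big1 ?div1r => [|e _]; last by have [_ _ ->] := Hs Sn on (oen e).
rewrite big1 ?invr1// => v _; by rewrite /vratio sratio_pole expr1n.
Qed.

Lemma cycle_sign_pm1 (C : {set Ed}) z : even_edges C -> off_graph z ->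
  cycle_sign C z = 1 \/ cycle_sign C z = -1.
Proof.
move=> eC oz; have /eqP := cycle_sign_sqr eC oz.
by rewrite sqrf_eq1 => /orP[]/eqP; [left|right].
Qed.

Lemma cycle_sign_const (C : {set Ed}) (U : set T) x y : even_edges C -> connected U ->
  U `<=` off_graph -> U x -> U y -> cycle_sign C x = 1 -> cycle_sign C y = 1.
Proof.
move=> eC cU sU Ux Uy Cx.
have h : 0 < Re (cycle_sign C y).
  apply: (connected_sgr (f := fun z => Re (cycle_sign C z)) cU _ _ Ux Uy).
  - apply/subspace_continuousP => z Uz.
    have [c _] := ccvg_cycle_sign C (sU z Uz).
    apply: cvg_trans c; by apply: cvg_fmap2; apply: within_subset => w /sU[].
  - by move=> w Uw; have [->|->] := cycle_sign_pm1 eC (sU w Uw); rewrite ?oppr_eq0 oner_eq0.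
  - by rewrite Cx ltr01.
have [//|e] := cycle_sign_pm1 eC (sU y Uy).
by move: h; rewrite e /= oppr_gt0 ltNge ler01.
Qed.

(** Solving the equality of signs for the factor [s e0] gives an expression [G] in which [e0] no
    longer occurs. It makes sense on the arc of [e0] away from the vertices, where no other arc
    passes, and continues [s e0] across it. *)
Lemma branch_extends (C C' : {set Ed}) e0 :
  even_edges C -> even_edges C' -> e0 \in C -> e0 \notin C' ->
  (forall z, S z -> off_vertices z -> off e0 z \/ forall e, e != e0 -> off e z) ->
  (forall z, off_graph z -> cycle_sign C z = cycle_sign C' z) ->
  exists tau : T -> R[i], forall z, S z -> off_vertices z ->
    tau z ^+ 2 = vratio (ept e0 false) z * vratio (ept e0 true) z /\
    ccvg (within S (nbhs z)) tau (tau z).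
Proof.
move=> eC eC' e0C e0C' cover sgnE.
pose G z := (vertex_prod C z * edge_prod C' z) /
  (vertex_prod C' z * edge_prod (C :\ e0) z).
have offC' z e : (forall e, e != e0 -> off e z) -> e \in C' -> off e z.
  by move=> oz eC'_; apply: oz; apply: contraNneq e0C' => <-.
have offC z e : (forall e, e != e0 -> off e z) -> e \in C :\ e0 -> off e z.
  by move=> oz; rewrite !inE => /andP[+ _]; apply: oz.
have sG z : off_graph z -> s e0 z = G z.
  move=> oz; have [Sz ovz oez] := oz.
  have := sgnE z oz; rewrite /cycle_sign {1}/edge_prod (big_setD1 e0)//=.
  rewrite -/(edge_prod (C :\ e0) z) /G => /eqP.
  have c0 := vertex_prod_neq0 C Sz ovz; have c'0 := vertex_prod_neq0 C' Sz ovz.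
  rewrite eqr_div// => /eqP h.
  have d0 : edge_prod (C :\ e0) z != 0 by apply: edge_prod_neq0.
  apply: (mulIf (mulf_neq0 c'0 d0)); rewrite divfK ?mulf_neq0//.
  by rewrite [RHS]mulrC -h; ring.
exists (fun z => if pselect (off e0 z) then s e0 z else G z) => z Sz ovz.
have nS : \forall x \near within S (nbhs z), S x by exact: withinT.
have nV := off_vertices_near Sz ovz.
case: pselect => oe0.
  have [s2 sc _] := Hs Sz ovz oe0; split => //.
  apply: near_eq_ccvg sc.
  by apply: filterS (off_arc_near cX cW (cE e0) Sz oe0) => x ?; case: pselect.
have oz : forall e, e != e0 -> off e z by have [] := cover z Sz ovz.
have c0 := vertex_prod_neq0 C Sz ovz; have c'0 := vertex_prod_neq0 C' Sz ovz.
have d0 : edge_prod (C :\ e0) z != 0.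
  by apply: edge_prod_neq0 => // e; apply: offC.
split.
  rewrite exprMn exprVn !exprMn !edge_prod_sqr// ?vertex_prod_sqr//; last first.
  - by move=> e; apply: offC'.
  - by move=> e; apply: offC.
  rewrite -!prod_vratio_degree [X in X * _ / _](big_setD1 e0)//=.
  set K := \prod_(i in C :\ e0) _; set K' := \prod_(i in C') _.
  have K0 : K != 0.
    by apply/prodf_neq0 => e _; rewrite mulf_neq0// vratio_neq0.
  have K'0 : K' != 0.
    by apply/prodf_neq0 => e _; rewrite mulf_neq0// vratio_neq0.
  by field; rewrite K0 K'0.
have cG : ccvg (within S (nbhs z)) G (G z).
  apply: ccvgM.
    apply: ccvgM; first exact: ccvg_vertex_prod.
    by apply: ccvg_edge_prod => // e; apply: offC'.
  apply: ccvgV; first by rewrite mulf_neq0.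
  apply: ccvgM; first exact: ccvg_vertex_prod.
  by apply: ccvg_edge_prod => // e; apply: offC.
apply: near_eq_ccvg cG.
have nE : \forall x \near within S (nbhs z), forall e, e != e0 -> off e x.
  apply: filter_forall => e; have [->|ee0] := eqVneq e e0.
    by apply: filterS nS.
  by apply: filterS (off_arc_near cX cW (cE e) Sz (oz e ee0)) => x.
(* Points off the arc of [e0] but close to it satisfy [sG], so [tau] and [G] agree on a whole
   neighbourhood. *)
apply: filterS3 nS nV nE => x Sx ovx oex; case: pselect => // oe0x.
apply/esym/sG; split => // e; have [->//|] := eqVneq e e0; exact: oex.
Qed.

End Signs.

(** * Absence of a branch around one vertex, and the bound on the number of edges *)

Section Circle.
Variable iota : R[i] -> T.
Hypothesis Siota : forall p, S (iota p).
Hypothesis Wiota : forall p, W (iota p) != 1.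
Hypothesis Xiota : forall p, X (iota p) = p * (1 - W (iota p))%:C.
Hypothesis ciota : forall c : R -> R[i], (forall t : R, ccvg (nbhs t) c (c t)) ->
  forall t : R, (fun t => iota (c t)) @ nbhs t --> iota (c t).

Lemma sform_iota p Q Q' :
  sf (iota p) Q Q' = (1 - W (iota p))%:C * ((p - Q) * (p - Q')^*).
Proof.
exact: (sform_affine XW).
Qed.

Lemma sratio_iota p Q Q' : p != Q' -> sr (iota p) Q Q' = (p - Q) / (p - Q').
Proof.
move=> pQ; rewrite /sratio !sform_iota.
have m0 : (1 - W (iota p))%:C != 0 :> R[i].
  by rewrite eq_complex /= eqxx andbT subr_eq0 eq_sym.
have h : p - Q' != 0 by rewrite subr_eq0.
have hJ : (p - Q')^* != 0 by rewrite conjc_eq0.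
by rewrite mulrA [in X in _ / X]mulrA -mulf_div divff// mulr1 -mulf_div divff ?mul1r.
Qed.

(* On the circle P u + x with |x| = r < |P u - P v|, the function
   F = tau (P u + x - P v0) satisfies F^2 = x (x + D), where D = P u - P v. So the
   square of omega t = F (t + pi) / F t is - (D - x) / (D + x), never a
   nonnegative real, and Im omega has no zero; but Im omega changes sign because
   omega (t + pi) * omega t = 1. *)
Lemma no_global_branch u v (tau : T -> R[i]) : injective P -> u != v ->
  ~ (forall z, S z -> off_vertices z -> tau z ^+ 2 = vratio u z * vratio v z /\
      ccvg (within S (nbhs z)) tau (tau z)).
Proof.
move=> Pinj uv Htau.
pose N (w : R[i]) := Re w ^+ 2 + Im w ^+ 2.
have N_gt0 w : w != 0 -> 0 < N w.
  case: w => a b; rewrite eq_complex /= => ab.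
  by rewrite lt0r addr_ge0 ?sqr_ge0// andbT paddr_eq0 ?sqr_ge0// !sqrf_eq0.
pose m := \big[Num.min/1]_(w | w != u) N (P w - P u).
have m0 : 0 < m.
  by apply: lt_bigmin => // w wu; apply: N_gt0; rewrite subr_eq0 (inj_eq Pinj).
have m1 : m <= 1 by exact: bigmin_le_id.
have mN w : w != u -> m <= N (P w - P u) by move=> wu; exact: bigmin_le_cond.
(* [m] is at most 1 and at most the squared distance from P u to any other vertex; hence r^2 < m,
   and the circle of radius r about P u has all other vertices outside. *)
pose r := m / 2.
have r0 : 0 < r by rewrite divr_gt0.
have rm : r ^+ 2 < m by rewrite /r; nra.
pose x (t : R) : R[i] := (r * cos t) +i* (r * sin t).
pose c t := P u + x t.
have Nx t : N (x t) = r ^+ 2.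
  by rewrite /N /= !exprMn -mulrDr cos2Dsin2 mulr1.
have x0 t : x t != 0.
  apply/eqP => h; have := Nx t; rewrite h /N /= expr0n addr0 => /esym/eqP.
  by rewrite sqrf_eq0 gt_eqF.
have xpi t : x (t + pi) = - x t by rewrite /x cosDpi sinDpi !mulrN.
have cP t w : c t != P w.
  apply/eqP => h; have [wu|wu] := eqVneq w u.
    by move/eqP: h; rewrite wu /c -subr_eq0 addrAC subrr add0r (negPf (x0 t)).
  have := mN w wu; rewrite -h /c addrAC subrr add0r Nx leNgt.
  by rewrite rm.
have ovc t : off_vertices (iota (c t)).
  move=> w; rewrite sform_iota mulf_neq0//.
    by rewrite eq_complex /= eqxx andbT subr_eq0 eq_sym.
  by rewrite mulf_neq0// ?conjc_eq0 subr_eq0.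
pose F t := tau (iota (c t)) * (c t - P v0).
have FE t : F t ^+ 2 = x t * (x t + (P u - P v)).
  have [t2 _] := Htau _ (Siota (c t)) (ovc t).
  rewrite exprMn t2 /vratio !sratio_iota//.
  have -> : x t + (P u - P v) = c t - P v by rewrite /c; ring.
  have -> : x t = c t - P u by rewrite /c; ring.
  by field; rewrite subr_eq0.
have F0 t : F t != 0.
  rewrite -sqrf_eq0 FE mulf_neq0//.
  by have -> : x t + (P u - P v) = c t - P v; [rewrite /c; ring|rewrite subr_eq0].
have cx (t : R) : ccvg (nbhs t) x (x t).
  by split => /=; apply: cvgM; [exact: cvg_cst|exact: continuous_cos|
    exact: cvg_cst|exact: continuous_sin].
have cc (t : R) : ccvg (nbhs t) c (c t) by apply: ccvgD => //; exact: ccvg_cst.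
have cF (t : R) : ccvg (nbhs t) F (F t).
  apply: ccvgM; last by apply: ccvgB => //; exact: ccvg_cst.
  have [_ [tr ti]] := Htau _ (Siota (c t)) (ovc t).
  have ci : (fun t => iota (c t)) @ nbhs t --> within S (nbhs (iota (c t))).
    move=> A /(ciota cc); apply: (@filterS _ (nbhs t)) => y; apply; exact: Siota.
  by split; [exact: (cvg_comp _ _ ci tr)|exact: (cvg_comp _ _ ci ti)].
pose om t := F (t + pi) / F t.
have com (t : R) : ccvg (nbhs t) om (om t).
  apply: ccvgM; last exact: ccvgV.
  have [fr fi] := cF (t + pi).
  have sh : (fun t => t + pi) @ nbhs t --> t + pi by apply: cvgD => //; exact: cvg_cst.
  by split; [exact: (cvg_comp _ _ sh fr)|exact: (cvg_comp _ _ sh fi)].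
(* A real value a would give D (1 + a^2) = x (1 - a^2) with D = P u - P v, hence |D| <= r, against
   the choice of r. *)
have Im_om t : Im (om t) != 0.
  apply/eqP => om0; pose a := Re (om t).
  have oma : om t = a%:C by move: om0; rewrite /a; case: (om t) => ? ? /= ->.
  have : F (t + pi) ^+ 2 = a%:C ^+ 2 * F t ^+ 2.
    by rewrite -oma -exprMn /om divfK.
  rewrite !FE xpi => h.
  have {}h : (P u - P v) * (1 + a ^+ 2)%:C = x t * (1 - a ^+ 2)%:C.
    apply: (mulfI (x0 t)).
    have -> : (1 + a ^+ 2)%:C = 1 + a%:C ^+ 2 by rewrite rmorphD rmorph1 rmorphXn.
    have -> : (1 - a ^+ 2)%:C = 1 - a%:C ^+ 2 by rewrite rmorphB rmorph1 rmorphXn.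
    apply/eqP; rewrite -subr_eq0; apply/eqP.
    transitivity (a%:C ^+ 2 * (x t * (x t + (P u - P v))) -
       (- x t * (- x t + (P u - P v)))); first by ring.
    by rewrite -h subrr.
  have NM w (k : R) : N (w * k%:C) = N w * k ^+ 2.
    by rewrite /N; case: w => p q /=; ring.
  have := congr1 N h; rewrite !NM Nx => {}h.
  have := mN v; rewrite eq_sym => /(_ uv).
  have -> : N (P v - P u) = N (P u - P v).
    by rewrite -opprB /N cReN cImN !sqrrN.
  move=> mD; have a2 : 0 <= a ^+ 2 by exact: sqr_ge0.
  have : r ^+ 2 * (1 - a ^+ 2) ^+ 2 <= r ^+ 2 * (1 + a ^+ 2) ^+ 2.
    by rewrite ler_pM2l ?exprn_gt0//; nra.
  rewrite -h ler_pM2r ?exprn_gt0//; last by lra.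
  lra.
have om_mul : om (0 + pi) * om 0 = 1.
  rewrite /om mulrA divfK//; have -> : F (0 + pi + pi) = F 0.
    by rewrite /F /c !xpi opprK.
  exact: divff.
have om_inv : om pi = (om 0)^-1.
  have o0 : om 0 != 0 by rewrite mulf_neq0// invr_eq0.
  by apply: (mulIf o0); rewrite mulVf// -[pi]add0r.
have c01 := @segment_connected R 0 pi.
have cIm : {within `[0, pi]%classic, continuous (fun t => Im (om t))}.
  by apply: continuous_subspaceT => t; have [_] := com t.
have in0 : `[0, pi]%classic (0 : R) by rewrite /= in_itv /= lexx pi_ge0.
have inpi : `[0, pi]%classic (pi : R) by rewrite /= in_itv /= lexx pi_ge0.
have sgn := connected_sgr c01 cIm (fun t _ => Im_om t).
have Im_pi : Im (om pi) = - (Im (om 0) / N (om 0)) by rewrite om_inv cImV.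
have N0 : 0 < N (om 0) by apply: N_gt0; rewrite mulf_neq0// invr_eq0.
have [] := ltrgt0P (Im (om 0)); last by move=> h; have := Im_om 0; rewrite h eqxx.
  move=> h0; have := sgn 0 pi in0 inpi h0.
  by rewrite Im_pi oppr_gt0 pmulr_llt0 ?invr_gt0// => /(lt_trans h0); rewrite ltxx.
move=> h; have : 0 < Im (om pi).
  by rewrite Im_pi oppr_gt0 pmulr_llt0 ?invr_gt0.
by move=> /(sgn pi 0 inpi in0) /(lt_trans h); rewrite ltxx.
Qed.

(** The m signs outside the region of the pole determine an even set, so there are at most 2^m of
    these; [even_edges_count] bounds their number from below. *)
Lemma euler_bound m (U : 'I_m.+1 -> set T) : injective P ->
  (forall e, ept e false != ept e true) ->
  (forall e0 z, S z -> off_vertices z -> off e0 z \/ forall e, e != e0 -> off e z) ->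
  (forall k, connected (U k)) -> (forall k, U k !=set0) ->
  (forall k, U k `<=` off_graph) -> (forall z, off_graph z -> exists k, U k z) ->
  off_graph n -> (#|Ed| < #|V| + m)%N.
Proof.
move=> Pinj noloop cover cU U0 sU covU on.
have [s Hs] := branch_exists.
have /choice[x Ux] := U0.
have [k0 Uk0] := covU n on.
have signE C k z z' : even_edges C -> U k z -> U k z' ->
    (cycle_sign s C z == 1) = (cycle_sign s C z' == 1).
  move=> eC Uz Uz'; apply/eqP/eqP; apply: (cycle_sign_const Hs eC (cU k)) => //; exact: sU.
(* [lift k0] skips the region of the pole, where every sign is 1. *)
pose sgn C : {ffun 'I_m -> bool} := [ffun k => cycle_sign s C (x (lift k0 k)) == 1].
have sgn_inj : {in [set C | even_edges C] &, injective sgn}.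
  move=> C C'; rewrite !inE => eC eC' /ffunP sE.
  have CC' z : off_graph z -> cycle_sign s C z = cycle_sign s C' z.
    move=> oz; have [k Uz] := covU z oz.
    have : (cycle_sign s C z == 1) = (cycle_sign s C' z == 1).
      have [j kE|kE] := unliftP k0 k.
        have := sE j; rewrite !ffunE -kE.
        by rewrite (signE _ _ _ _ eC (Ux k) Uz) (signE _ _ _ _ eC' (Ux k) Uz).
      rewrite kE in Uz; rewrite (signE _ _ _ _ eC Uz Uk0) (signE _ _ _ _ eC' Uz Uk0).
      by rewrite !(cycle_sign_pole Hs).
    have n11 : (-1 : R[i]) == 1 = false.
      by rewrite eq_complex /= oppr0 eqxx andbT; apply/eqP; lra.
    case: (cycle_sign_pm1 Hs eC oz) => ->; case: (cycle_sign_pm1 Hs eC' oz) => -> //.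
      by rewrite eqxx n11.
    by rewrite eqxx n11.
  (* An edge in only one of two sets with equal signs would have a branch that extends across it. *)
  have H (D D' : {set Ed}) e0 : even_edges D -> even_edges D' ->
      (forall z, off_graph z -> cycle_sign s D z = cycle_sign s D' z) ->
      e0 \in D -> e0 \in D'.
    move=> eD eD' DD' e0D; apply: contrapT => /negP e0D'.
    have [tau Htau] := branch_extends Hs eD eD' e0D e0D' (cover e0) DD'.
    exact: (no_global_branch Pinj (noloop e0) Htau).
  by apply/finset.setP => e; apply/idP/idP; apply: H => // z oz; rewrite CC'.
have := even_edges_count ept v0.
have : (#|[set C | even_edges C]| <= 2 ^ m)%N.
  rewrite -(card_in_imset sgn_inj); apply: leq_trans (max_card _) _.
  by rewrite card_ffun card_bool card_ord.
move=> h /leq_trans/(_ (leq_mul (leqnn _) h)); rewrite -expnD leq_exp2l//.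
move=> /leq_ltn_trans; apply; rewrite ltn_add2r prednK//.
by apply/card_gt0P; exists v0.
Qed.

End Circle.
End ArcSystem.

(** * Stereographic projection from an arbitrary point *)

Section Chart.
Variable R : realType.
Implicit Types z w : 'rV[R]_3.

Let i0 : 'I_3 := ord0.
Let i1 : 'I_3 := lift ord0 ord0.
Let i2 : 'I_3 := lift ord0 (lift ord0 ord0).

Lemma row3P z w : z 0 i0 = w 0 i0 -> z 0 i1 = w 0 i1 -> z 0 i2 = w 0 i2 -> z = w.
Proof.
move=> h0 h1 h2; apply/rowP => i.
have [j ->|->//] := unliftP ord0 i; have [k ->|->//] := unliftP ord0 j.
by rewrite (ord1 k).
Qed.

Lemma cvg_row (I : Type) (F : set_system I) (f : I -> 'rV[R]_3) z : Filter F ->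
  (forall i, (fun x => f x 0 i) @ F --> z 0 i) -> f @ F --> z.
Proof.
move=> FF fz A [B Bz BA]; apply: (filterS (P := fun x => forall j, B 0 j (f x 0 j))).
  by move=> x Bx; apply: BA => i j; rewrite (ord1 i).
by apply: filter_forall => j; apply: fz; apply: Bz.
Qed.

Definition dot3 z w : R := z 0 i0 * w 0 i0 + z 0 i1 * w 0 i1 + z 0 i2 * w 0 i2.

Lemma sphereE z : sphere z <-> dot3 z z = 1.
Proof.
rewrite /sphere /= !big_ord_recl big_ord0 addr0 addrA /dot3 !expr2.
by split.
Qed.

Variable n : 'rV[R]_3.
Hypothesis Sn : sphere n.

(* The reflection exchanging n and the north pole; it is the identity when
   n is the pole, as then k = 0^-1 = 0. *)
Let pole : 'rV[R]_3 := delta_mx 0 i2.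
Let m := n - pole.
Let k := (1 - n 0 i2)^-1.
Let h z := z - (k * dot3 z m) *: m.

Let hE z i : h z 0 i = z 0 i - k * dot3 z m * m 0 i.
Proof. by rewrite /h !mxE. Qed.

(** This form of k (1 - n 0 i2) = 1 survives the case k = 0. *)
Let kk : k * k * (1 - n 0 i2) = k.
Proof.
rewrite /k; have [->|h0] := eqVneq (1 - n 0 i2) 0; first by rewrite invr0 !mul0r.
by rewrite -mulrA mulVf// mulr1.
Qed.

(** When [n] is not the north pole, k is thus 2 / |m|^2 and [h] is the orthogonal reflection in the
    plane normal to m. *)
Let mm : dot3 m m = 2 * (1 - n 0 i2).
Proof.
have := (sphereE n).1 Sn; rewrite /dot3 /m /pole !mxE /= => e.
rewrite !subr0 mulr1n; transitivity
  (n 0 i0 * n 0 i0 + n 0 i1 * n 0 i1 + n 0 i2 * n 0 i2 + 1 - 2 * n 0 i2); first by ring.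
by rewrite e; ring.
Qed.

Let dot3_h z : dot3 (h z) m = dot3 z m * (1 - k * dot3 m m).
Proof. rewrite {1}/dot3 !hE /dot3; ring. Qed.

Let hK z : h (h z) = z.
Proof.
apply/rowP => i; rewrite hE dot3_h mm hE.
transitivity (z 0 i - 2 * (k - k * k * (1 - n 0 i2)) * dot3 z m * m 0 i); first by ring.
by rewrite kk subrr mulr0 !mul0r subr0.
Qed.

Let dot3_hh z : dot3 (h z) (h z) = dot3 z z.
Proof.
rewrite [LHS]/dot3 !hE.
transitivity (dot3 z z - 2 * k * dot3 z m * (z 0 i0 * m 0 i0 + z 0 i1 * m 0 i1 + z 0 i2 * m 0 i2)
   + k * k * dot3 z m ^+ 2 * dot3 m m); first by rewrite [dot3 z z]/dot3 [dot3 m m]/dot3; ring.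
rewrite -/(dot3 z m) mm.
transitivity (dot3 z z - 2 * dot3 z m ^+ 2 * (k - k * k * (1 - n 0 i2))); first by ring.
by rewrite kk subrr mulr0 subr0.
Qed.

Let hn : h n = pole.
Proof.
have e := (sphereE n).1 Sn; rewrite /dot3 in e.
have nm : dot3 n m = 1 - n 0 i2.
  rewrite /dot3 /m /pole !mxE /= !subr0 mulr1n; transitivity
    (n 0 i0 * n 0 i0 + n 0 i1 * n 0 i1 + n 0 i2 * n 0 i2 - n 0 i2); first by ring.
  by rewrite e.
have [h0|h0] := eqVneq (1 - n 0 i2) 0.
  have n2 : n 0 i2 = 1 by lra.
  have e2 : n 0 i0 ^+ 2 + n 0 i1 ^+ 2 == 0 by rewrite n2 in e; apply/eqP; lra.
  move: e2; rewrite paddr_eq0 ?sqr_ge0// !sqrf_eq0 => /andP[/eqP n0 /eqP n1].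
  have k0 : k = 0 by rewrite /k h0 invr0.
  by apply: row3P; rewrite hE k0 !mul0r subr0 /pole !mxE.
have kn : k * dot3 n m = 1 by rewrite nm mulVf.
by rewrite /h kn scale1r /m opprB addrC subrK.
Qed.

(** After the reflection [n] is the north pole, and [chartX] / (1 - [chartW]) is the stereographic
    coordinate. *)
Definition chartX z : R[i] := h z 0 i0 +i* h z 0 i1.
Definition chartW z : R := h z 0 i2.

Lemma chart_eq z : sphere z ->
  chartX z * (chartX z)^* = (1 + chartW z)%:C * (1 - chartW z)%:C.
Proof.
move=> /sphereE; rewrite -dot3_hh /dot3 /chartX /chartW => e.
apply/eqP; rewrite eq_complex /=; apply/andP; split; apply/eqP; last by ring.
rewrite mul0r subr0.
have -> : (1 + h z 0 i2) * (1 - h z 0 i2) = 1 - h z 0 i2 * h z 0 i2 by ring.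
rewrite -{1}e; ring.
Qed.

Let h_cvg z i : (fun x => h x 0 i) @ nbhs z --> h z 0 i.
Proof.
rewrite hE; under eq_fun do rewrite hE.
have c j : (fun x : 'rV[R]_3 => x 0 j) @ nbhs z --> z 0 j by exact: coord_continuous.
apply: cvgB => //; apply: cvgM; last exact: cvg_cst.
apply: cvgM; first exact: cvg_cst.
by apply: cvgD; [apply: cvgD|]; apply: cvgM; rewrite ?c//; exact: cvg_cst.
Qed.

Lemma ccvg_chartX z : ccvg (nbhs z) chartX (chartX z).
Proof. by split; exact: h_cvg. Qed.

Lemma cvg_chartW z : chartW @ nbhs z --> chartW z.
Proof. exact: h_cvg. Qed.

Lemma chartX_pole : chartX n = 0.
Proof. by rewrite /chartX hn /pole !mxE. Qed.

Lemma chartW_pole : chartW n = 1.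
Proof. by rewrite /chartW hn /pole !mxE. Qed.

(** The equation of the sphere becomes |p|^2 (1 - W) = 1 + W, which is solved for W. *)
Let chart_W_affine z (p : R[i]) : sphere z -> chartW z != 1 ->
  chartX z = p * (1 - chartW z)%:C ->
  chartW z = 1 - 2 / (Re p ^+ 2 + Im p ^+ 2 + 1).
Proof.
move=> Sz Wz Xz; have := chart_eq Sz; rewrite Xz; set w := chartW z.
have w0 : 1 - w != 0 by rewrite subr_eq0 eq_sym.
case: p Xz => a b _ /eqP; rewrite eq_complex /= => /andP[/eqP e _].
have s0 : a ^+ 2 + b ^+ 2 + 1 != 0 by rewrite gt_eqF// ltr_wpDl// addr_ge0// sqr_ge0.
have {}e : (a ^+ 2 + b ^+ 2) * (1 - w) = 1 + w.
  apply: (mulIf w0); transitivity ((1 + w) * (1 - w) - 0 * 0); last by ring.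
  rewrite -e; ring.
apply: (mulIf s0); rewrite mulrBl divfK//; lra.
Qed.

Lemma chart_inj z z' (p : R[i]) : sphere z -> sphere z' ->
  chartW z != 1 -> chartW z' != 1 ->
  chartX z = p * (1 - chartW z)%:C -> chartX z' = p * (1 - chartW z')%:C -> z = z'.
Proof.
move=> Sz Sz' Wz Wz' Xz Xz'.
have WW : chartW z = chartW z'.
  by rewrite (chart_W_affine Sz Wz Xz) (chart_W_affine Sz' Wz' Xz').
have := Xz; rewrite WW -Xz' => /eqP; rewrite eq_complex /= => /andP[/eqP h0 /eqP h1].
by rewrite -[z]hK -[z']hK; congr h; apply: row3P.
Qed.

Lemma chart_pole_inj z : sphere z -> chartW z = 1 -> z = n.
Proof.
move=> Sz Wz; have := chart_eq Sz; rewrite Wz subrr mulr0 => /eqP.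
rewrite mulf_eq0 conjc_eq0 orbb eq_complex /= => /andP[/eqP h0 /eqP h1].
by rewrite -[z]hK -[n]hK hn; congr h; apply: row3P; rewrite [RHS]mxE.
Qed.

(** Inverse stereographic projection from the north pole, before reflecting by [h]. *)
Let unchart (p : R[i]) : 'rV[R]_3 :=
  \row_i (if i == i0 then 2 * Re p / (Re p ^+ 2 + Im p ^+ 2 + 1) else
          if i == i1 then 2 * Im p / (Re p ^+ 2 + Im p ^+ 2 + 1) else
          1 - 2 / (Re p ^+ 2 + Im p ^+ 2 + 1)).

Definition chart_inv p := h (unchart p).

Let s0 (p : R[i]) : Re p ^+ 2 + Im p ^+ 2 + 1 != 0.
Proof. by rewrite gt_eqF// ltr_wpDl// addr_ge0// sqr_ge0. Qed.

Lemma sphere_chart_inv p : sphere (chart_inv p).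
Proof.
apply/sphereE; rewrite dot3_hh /dot3 /unchart !mxE /=; field; exact: s0.
Qed.

Lemma chartW_inv p : chartW (chart_inv p) != 1.
Proof.
rewrite /chartW /chart_inv hK /unchart mxE /= -subr_eq0 addrAC subrr add0r.
by rewrite oppr_eq0 mulf_neq0 ?invr_eq0 ?s0.
Qed.

Lemma chartX_inv p : chartX (chart_inv p) = p * (1 - chartW (chart_inv p))%:C.
Proof.
rewrite /chartX /chartW /chart_inv hK /unchart !mxE /=.
have := s0 p; case: p => a b /= ab0; apply/eqP; rewrite eq_complex /=.
by apply/andP; split; apply/eqP; field.
Qed.

Lemma cvg_chart_inv (c : R -> R[i]) : (forall t : R, ccvg (nbhs t) c (c t)) ->
  forall t : R, (fun t => chart_inv (c t)) @ nbhs t --> chart_inv (c t).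
Proof.
move=> cc t; have [cr ci] := cc t.
have sc : (fun t => (Re (c t) ^+ 2 + Im (c t) ^+ 2 + 1)^-1) @ nbhs t -->
    (Re (c t) ^+ 2 + Im (c t) ^+ 2 + 1)^-1.
  apply: cvgV; first exact: s0.
  by apply: cvgD; [apply: cvgD; exact: cvg_sqr|exact: cvg_cst].
have cu : (fun t => unchart (c t)) @ nbhs t --> unchart (c t).
  apply: cvg_row => i; rewrite mxE; under eq_fun do rewrite mxE.
  case: eqP => _; [|case: eqP => _].
  - by apply: cvgM => //; apply: cvgM => //; exact: cvg_cst.
  - by apply: cvgM => //; apply: cvgM => //; exact: cvg_cst.
  - apply: cvgB; first exact: cvg_cst.
    by apply: cvgM => //; exact: cvg_cst.
apply: cvg_row => i; exact: (cvg_comp _ _ cu (h_cvg (i := i))).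
Qed.

End Chart.

(** * Embedded graphs *)

Section GraphEuler.
Variables (R : realType) (G : drawn_graph R).
Hypothesis emb : nicely_embedded G.

(** Curves are controlled on [0, 1] only; clamping the parameter extends them continuously to the
    whole line. *)
Definition clamp01 (t : R) : R := Num.max 0 (Num.min t 1).

Lemma clamp01_itv t : 0 <= clamp01 t <= 1.
Proof. by rewrite /clamp01 le_max lexx /= ge_max ler01 ge_min lexx orbT. Qed.

Lemma clamp01_id t : 0 <= t <= 1 -> clamp01 t = t.
Proof.
by move=> /andP[t0 t1]; rewrite /clamp01 (min_idPl t1); apply/max_idPr.
Qed.

Lemma continuous_clamp01 : continuous clamp01.
Proof.
move=> t; apply: (@continuous_max _ _ _ _ t); first exact: cst_continuous.
apply: (@continuous_min _ _ _ _ t); [exact: cvg_id|exact: cst_continuous].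
Qed.

Lemma curve_clamp_continuous (e : edge G) : continuous (fun t => curve e (clamp01 t)).
Proof.
move=> t; have /subspace_continuousP/(_ (clamp01 t)) := @curve_continuous _ _ emb e.
rewrite /= in_itv /= => /(_ (clamp01_itv t)) c.
apply: cvg_comp c; move=> A /continuous_clamp01; apply: (@filterS _ (nbhs t)) => x; apply.
by rewrite /= in_itv /= clamp01_itv.
Qed.

Lemma curve_sphere01 (e : edge G) t : 0 <= t <= 1 -> sphere (curve e t).
Proof. by move=> t01; apply: (curve_sphere emb (e := e)); exists t; rewrite //= in_itv. Qed.

Lemma edge_skeleton (e : edge G) t : 0 <= t <= 1 -> skeleton G (curve e t).
Proof. by move=> t01; right; exists e => //; exists t; rewrite //= in_itv. Qed.

(** With F = m + 1 faces this reads E - V <= F - 2. The chart is centred at a point of the face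
    [U ord0], so the skeleton avoids the pole. *)
Lemma graph_euler m (U : 'I_m.+1 -> set 'rV[R]_3) (v0 : vertex G) :
  (forall e : edge G, endpt e false != endpt e true) ->
  (forall k, faces G (U k)) -> (forall F, faces G F -> exists k, F = U k) ->
  (#|edge G| < #|vertex G| + m)%N.
Proof.
move=> noloop fU Uf.
have [n [Sn nsk] _] := fU ord0.
pose phi z : R[i] := chartX n z / (1 - chartW n z)%:C.
have W1 z : sphere z -> z <> n -> (1 - chartW n z)%:C != 0 :> R[i].
  move=> Sz zn; rewrite eq_complex /= eqxx andbT subr_eq0 eq_sym; apply/eqP => h.
  exact/zn/(chart_pole_inj Sn Sz h).
have W1' z : sphere z -> z <> n -> chartW n z != 1.
  by move=> Sz zn; apply/eqP => h; apply/zn/(chart_pole_inj Sn Sz h).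
have Xphi z : sphere z -> z <> n -> chartX n z = phi z * (1 - chartW n z)%:C.
  by move=> Sz zn; rewrite /phi divfK// W1.
have skn z : skeleton G z -> z <> n by move=> sz zn; apply: nsk; rewrite -zn.
have XW := chart_eq Sn.
(* Together with [s0]: the form at the coordinate of p vanishes only at z = p, so being off the arcs
   and vertices in the chart means being off the skeleton. *)
have sn0 z p : sphere z -> sphere p -> p <> n -> z <> p ->
    sform (chartX n) (chartW n) z (phi p) (phi p) != 0.
  move=> Sz Sp pn zp; have [zn|zn] := pselect (z = n).
    by rewrite zn (sform_pole (chartX_pole Sn) (chartW_pole Sn)) pnatr_eq0.
  rewrite (sform_affine XW _ _ Sz (W1' _ Sz zn) (Xphi _ Sz zn)) mulf_neq0 ?W1//.
  have h : phi z - phi p != 0.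
    rewrite subr_eq0; apply/eqP => h; apply: zp.
    by apply: (chart_inj Sn Sz Sp (W1' _ Sz zn) (W1' _ Sp pn) (Xphi _ Sz zn)); rewrite h Xphi.
  by rewrite mulf_neq0 ?conjc_eq0.
have s0 z : sphere z -> z <> n -> sform (chartX n) (chartW n) z (phi z) (phi z) = 0.
  move=> Sz zn; rewrite (sform_affine XW _ _ Sz (W1' _ Sz zn) (Xphi _ Sz zn)).
  by rewrite subrr mul0r mulr0.
pose P (v : vertex G) := phi (pos v).
pose E (e : edge G) t := phi (curve e (clamp01 t)).
have skpos (v : vertex G) : skeleton G (pos v) by left; exists v.
have Spos := pos_sphere emb.
have Sc (e : edge G) t : sphere (curve e (clamp01 t)).
  exact: curve_sphere01 (clamp01_itv t).
have skc (e : edge G) t : skeleton G (curve e (clamp01 t)).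
  exact: edge_skeleton (clamp01_itv t).
have cE (e : edge G) (t : R) : ccvg (nbhs t) (E e) (E e t).
  have cc := @curve_clamp_continuous e t.
  have [xr xi] := @ccvg_chartX _ n (curve e (clamp01 t)).
  have w := @cvg_chartW _ n (curve e (clamp01 t)).
  apply: ccvgM; first by split; [exact: (cvg_comp _ _ cc xr)|exact: (cvg_comp _ _ cc xi)].
  apply: ccvgV; first exact/W1/skn.
  apply: ccvg_real; apply: cvgB; [exact: cvg_cst|exact: (cvg_comp _ _ cc w)].
have E0 (e : edge G) : E e 0 = P (endpt e false).
  by rewrite /E clamp01_id ?lexx ?ler01// (curve0 emb).
have E1 (e : edge G) : E e 1 = P (endpt e true).
  by rewrite /E clamp01_id ?lexx ?ler01// (curve1 emb).
have Pinj : injective P.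
  move=> u v uv; apply: (pos_inj emb).
  have un := skn _ (skpos u); have vn := skn _ (skpos v).
  apply: (chart_inj Sn (Spos u) (Spos v) (W1' _ (Spos u) un) (W1' _ (Spos v) vn)
    (Xphi _ (Spos u) un)).
  by rewrite -/(P u) uv Xphi.
have offE z : off_graph (@sphere R) (chartX n) (chartW n) P E z <->
    sphere z /\ ~ skeleton G z.
  split=> [[Sz ov oe]|[Sz nz]].
    split => // -[[v _ vz]|[e _ [t t01 ez]]].
      by have := ov v; rewrite /P vz s0 ?eqxx//; rewrite -vz; apply: skn.
    rewrite /= in_itv /= in t01.
    have := oe e t t01; rewrite /E clamp01_id// ez s0 ?eqxx//.
    by rewrite -ez; apply/skn/edge_skeleton.
  split => // [v|e t t01].
    by apply: sn0 => //; [exact: skn|move=> zv; apply: nz; rewrite zv].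
  apply: sn0 => //; first exact: skn.
  by move=> ze; apply: nz; rewrite ze.
have on_arc z (e : edge G) : sphere z -> off_vertices (chartX n) (chartW n) P z ->
    ~ off_arc (chartX n) (chartW n) (E e) z -> exists2 t, 0 < t < 1 & z = curve e t.
  move=> Sz ov /existsNP[t] /not_implyP[t01 /negP/negPn/eqP h].
  have ze : z = curve e t.
    apply: contrapT => ze; move: h; apply/eqP; apply: sn0 => //; first exact: skn.
    by rewrite clamp01_id.
  exists t => //; have /andP[t0 t1] := t01.
  rewrite !lt_neqAle t0 t1 !andbT; apply/andP; split; apply/eqP => tE.
    by have := ov (endpt e false); rewrite -E0 tE h eqxx.
  by have := ov (endpt e true); rewrite -E1 -tE h eqxx.
have cov (e0 : edge G) z : sphere z -> off_vertices (chartX n) (chartW n) P z ->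
    off_arc (chartX n) (chartW n) (E e0) z \/
    forall e, e != e0 -> off_arc (chartX n) (chartW n) (E e) z.
  move=> Sz ov.
  have [?|] := pselect (off_arc (chartX n) (chartW n) (E e0) z); first by left.
  move=> /(on_arc _ _ Sz ov)[t t01 zt].
  right => e ee0; apply: contrapT => /(on_arc _ _ Sz ov)[t' t'01 zt'].
  have [ee _] := curve_disjoint emb t'01 t01 (etrans (esym zt') zt).
  by rewrite ee eqxx in ee0.
have Ucc k : exists2 x, sphere x /\ ~ skeleton G x &
    U k = connected_component (@sphere R `\` skeleton G) x.
  by have [x ? <-] := fU k; exists x.
apply: (euler_bound (S := @sphere R) XW _ _ v0 cE E0 E1 Sn (chartX_pole Sn)
  (chartW_pole Sn) (sphere_chart_inv Sn) (chartW_inv Sn) (chartX_inv Sn)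
  (@cvg_chart_inv _ n) (U := U) Pinj noloop cov) => //.
- move=> z Sz; have [xr xi] := @ccvg_chartX _ n z.
  by split; apply: cvg_trans (cvg_app _ _) _;
    [exact: cvg_within|exact: xr|exact: cvg_within|exact: xi].
- move=> z Sz; apply: cvg_trans (cvg_app _ (@cvg_within _ _ _ _)) _.
  exact: @cvg_chartW _ n z.
- by move=> k; have [x _ ->] := Ucc k; exact: component_connected.
- by move=> k; have [x sx ->] := Ucc k; exists x; apply: connected_component_refl.
- by move=> k z; have [x _ ->] := Ucc k; move=> /connected_component_sub[? ?]; apply/offE.
- move=> z /offE[Sz nz].
  have [|k kE] := Uf (connected_component (@sphere R `\` skeleton G) z); first by exists z.
  by exists k; rewrite -kE; apply: connected_component_refl.
- exact/offE.
Qed.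

End GraphEuler.

(** Convexity of a half-line, applied coordinatewise to segments in a box or a half plane. *)
Lemma segment_lt (R : realType) (u v t r : R) :
  0 <= t -> t <= 1 -> u < r -> v < r -> u + t * (v - u) < r.
Proof.
move=> t0 t1 ur vr; have [uv|uv] := leP u v.
  have : t * (v - u) <= v - u by rewrite ler_piMl// subr_ge0.
  lra.
have : t * (v - u) <= 0 by rewrite mulr_ge0_le0// subr_le0 ltW.
lra.
Qed.

(** * The two sides of an edge *)

Section EdgeSides.
Variables (R : realType) (G : drawn_graph R).
Hypothesis emb : nicely_embedded G.

Let face_at := connected_component (@sphere R `\` skeleton G).

Lemma edge_set_closed (e : edge G) : closed (edge_set e).
Proof.
apply: compact_closed; first exact: norm_hausdorff.
by apply: continuous_compact; [exact: (@curve_continuous _ _ emb)|exact: segment_compact].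
Qed.

Let half01 : 0 < (2^-1 : R) < 1. Proof. by lra. Qed.

(** An interior point lies on one edge only; the point of parameter 1/2 is used throughout as the
    witness of its edge. *)
Lemma midpoint_edge (e e' : edge G) : edge_set e' (curve e 2^-1) -> e' = e.
Proof.
case=> t; rewrite /= in_itv /= => /andP[t0 t1] te.
have [tE|t0'] := eqVneq t 0.
  case: (curve_pos emb (e := e) half01 (v := endpt e' false)); by rewrite -te tE (curve0 emb).
have [tE|t1'] := eqVneq t 1.
  case: (curve_pos emb (e := e) half01 (v := endpt e' true)); by rewrite -te tE (curve1 emb).
have t01 : 0 < t < 1 by rewrite !lt_neqAle t0 t1 eq_sym t0' t1'.
by have [] := curve_disjoint emb t01 half01 te.
Qed.

Lemma near_edge_midpoint (e : edge G) : \forall y \near curve e 2^-1,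
  skeleton G y -> edge_set e y.
Proof.
have nE : \forall y \near curve e 2^-1, forall e' : edge G, e' != e -> ~ edge_set e' y.
  refine (@filter_forall _ (edge G) (fun e' y => e' != e -> ~ edge_set e' y)
    _ (nbhs_filter _) _) => e'.
  have [->|ee'] := eqVneq e' e.
    exact: nearW.
  have : nbhs (curve e 2^-1) (~` edge_set e').
    apply: open_nbhs_nbhs; split; first exact/closed_openC/edge_set_closed.
    by move=> /midpoint_edge ee; rewrite ee eqxx in ee'.
  by apply: filterS => y ey _.
have nV : \forall y \near curve e 2^-1, forall v : vertex G, y <> pos v.
  refine (@filter_forall _ (vertex G) (fun v y => y <> pos v)
    _ (nbhs_filter _) _) => v.
  apply: open_nbhs_nbhs; split; last exact: (curve_pos emb half01).
  apply/closed_openC/accessible_closed_set1/hausdorff_accessible.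
  exact: norm_hausdorff.
apply: filterS2 nE nV => y nE nV [[v _ yv]|[e' _ e'y]]; first by case: (nV v).
by have [<-//|/nE] := eqVneq e' e.
Qed.

(** In a flat chart at the midpoint, a small box meets the skeleton only in the axis, and each open
    half of the box lies in one face. A face having the midpoint in its closure meets one of the
    halves. The two faces may coincide. *)
Lemma edge_two_faces (e : edge G) : exists U1 U2 : set 'rV[R]_3,
  [/\ faces G U1, closure U1 (curve e 2^-1)
    & forall U, faces G U -> closure U (curve e 2^-1) -> U = U1 \/ U = U2].
Proof.
set x := curve e 2^-1.
have ex : edge_set e x by exists 2^-1 => //; rewrite /= in_itv /=; lra.
have [Q [f [g [[oQ Nx] [cf cg] gf fg flat]]]] := curve_flat emb e half01.
have fx2 : (f x).2 = 0 by apply/flat.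
pose a := (f x).1.
have fxE : f x = (a, 0) by rewrite -fx2 /a; case: (f x).
have gax : g (a, 0) = x by rewrite -fxE gf.
pose box (r : R) (p : R * R) := `|p.1 - a| < r /\ `|p.2| < r.
have box_nbhs (r : R) : 0 < r -> nbhs (a, 0 : R) (box r).
  move=> r0; apply/nbhs_ballP; exists r => //= p [/= p1 p2]; split.
    by rewrite distrC.
  by move: p2; rewrite /ball /= sub0r normrN.
have [r r0 rE] : exists2 r : R, 0 < r & forall p, box r p -> skeleton G (g p) -> edge_set e (g p).
  have : nbhs (a, 0 : R) (g @^-1` [set y | skeleton G y -> edge_set e y]).
    by apply: cg; rewrite gax; exact: near_edge_midpoint.
  move=> /nbhs_ballP[r /= r0 rE]; exists r => // p [p1 p2]; apply: rE.
  by split => /=; [rewrite /ball /= distrC|rewrite /ball /= sub0r normrN].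
have offg p : box r p -> p.2 != 0 -> (@sphere R `\` skeleton G) (g p).
  move=> bp p2; have [[Qg Sg] fgp] := fg p; split => // /(rE _ bp) /(flat _ (conj Qg Sg)).
  by rewrite fgp; apply/eqP.
(* A segment avoiding the axis p.2 = 0 stays on one side of the edge. *)
have side p q : box r p -> box r q -> 0 < p.2 * q.2 -> face_at (g p) (g q).
  move=> bp bq pq.
  pose c (t : R) : R * R := (p.1 + t * (q.1 - p.1), p.2 + t * (q.2 - p.2)).
  have cc : continuous c.
    have aff (y d t : R) : (fun t => y + t * d) @ nbhs t --> y + t * d.
      by apply: cvgD; [exact: cvg_cst|apply: cvgM; [exact: cvg_id|exact: cvg_cst]].
    by move=> t; apply: (@cvg_pair _ _ _ _ (nbhs (p.1 + t * (q.1 - p.1)))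
      (nbhs (p.2 + t * (q.2 - p.2)))); exact: aff.
  have cgc : {within `[0, 1]%classic, continuous (g \o c)}.
    by apply: continuous_subspaceT => t; apply: continuous_comp; [exact: cc|exact: cg].
  have h := connected_continuous_connected (@segment_connected R 0 1) cgc.
  apply: (connected_component_max _ _ h).
  - exists 0; first by rewrite /= in_itv /= lexx ler01.
    by rewrite /c /= !mul0r !addr0; case: (p).
  - move=> _ [t + <-]; rewrite /= in_itv /= => /andP[t0 t1].
    move: bp bq pq => [p1 p2] [q1 q2] pq; apply: offg.
      split; rewrite /c /=.
        have := @segment_lt _ (p.1 - a) (q.1 - a) t r t0 t1.
        have := @segment_lt _ (a - p.1) (a - q.1) t r t0 t1.
        move: p1 q1; rewrite !ltr_norml => /andP[? ?] /andP[? ?] h1 h2.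
        have {}h1 : a - p.1 + t * (a - q.1 - (a - p.1)) < r by apply: h1; lra.
        have {}h2 : p.1 - a + t * (q.1 - a - (p.1 - a)) < r by apply: h2; lra.
        apply/andP; split; lra.
      have := @segment_lt _ p.2 q.2 t r t0 t1.
      have := @segment_lt _ (- p.2) (- q.2) t r t0 t1.
      move: p2 q2; rewrite !ltr_norml => /andP[? ?] /andP[? ?] h1 h2.
      have {}h1 : - p.2 + t * (- q.2 - - p.2) < r by apply: h1; lra.
      have {}h2 : p.2 + t * (q.2 - p.2) < r by apply: h2; lra.
      apply/andP; split; lra.
    rewrite /c /=; have [p20|p20|p20] := ltrgt0P p.2; last by rewrite p20 mul0r ltxx in pq.
      have q20 : 0 < q.2 by rewrite pmulr_rgt0 in pq.
      have := @segment_lt _ (- p.2) (- q.2) t 0 t0 t1.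
      by rewrite !oppr_lt0 => /(_ p20 q20) h1; rewrite gt_eqF//; lra.
    have q20 : q.2 < 0 by rewrite nmulr_rgt0 in pq.
    have h1 := @segment_lt _ p.2 q.2 t 0 t0 t1 p20 q20.
    by rewrite lt_eqF.
  - exists 1; first by rewrite /= in_itv /= lexx ler01.
    by rewrite /c /= !mul1r ![_ + (_ - _)]addrC !subrK; case: (q).
pose u : R * R := (a, r / 2); pose l : R * R := (a, - (r / 2)).
have bu : box r u by split; rewrite /= ?subrr ?normr0// ger0_norm; lra.
have bl : box r l by split; rewrite /= ?subrr ?normr0// normrN ger0_norm; lra.
have su : (@sphere R `\` skeleton G) (g u) by apply: offg => //=; rewrite gt_eqF//; lra.
exists (face_at (g u)), (face_at (g l)); split.
- by exists (g u).
- move=> B Bx.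
  have : nbhs (a, 0 : R) (g @^-1` B) by apply: cg; rewrite gax.
  move=> /nbhs_ballP[d /= d0 dB].
  pose s := Num.min d r / 2.
  have [s0 sd sr] : [/\ 0 < s, s < d & s < r].
    by rewrite /s; split; case: (leP d r); lra.
  exists (g (a, s)); split.
    apply: side => //=; last by rewrite mulr_gt0//; lra.
    by split; rewrite /= ?subrr ?normr0// gtr0_norm.
  by apply: dB; split => /=; rewrite /ball /= ?subrr ?normr0// sub0r normrN gtr0_norm.
- move=> U [z sz <-] clU.
  have nf : nbhs x [set y | (Q `&` @sphere R) y -> box r (f y)].
    have cfx : f @ within (Q `&` @sphere R) (nbhs x) --> (a, 0 : R).
      by rewrite -fxE; exact: ((subspace_continuousP _ f).1 cf x Nx).
    exact: (cfx _ (box_nbhs r r0)).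
  have nQ : nbhs x Q by apply: open_nbhs_nbhs; split => //; exact: Nx.1.
  have [y [Uy [bfy Qy]]] := clU _ (filterI nf nQ).
  have [Sy nsy] := connected_component_sub Uy.
  have {}bfy := bfy (conj Qy Sy).
  have fy2 : (f y).2 != 0.
    apply/eqP => /(flat y (conj Qy Sy)) ey; apply: nsy; right; by exists e.
  rewrite (same_connected_component Uy) -(gf y (conj Qy Sy)).
  have [y2|y2|y2] := ltrgt0P (f y).2; last by rewrite y2 eqxx in fy2.
    left; apply/esym/same_connected_component; apply: (side u (f y) bu bfy).
    by rewrite mulr_gt0//=; lra.
  right; apply/esym/same_connected_component; apply: (side l (f y) bl bfy).
  by rewrite nmulr_rgt0//=; lra.
Qed.

End EdgeSides.

(** * Twelve pentagons *)

Section Pentagons.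
Variables (V Ed : finType) (ept : Ed -> bool -> V).
Variable p : 'I_12 -> 'I_5 -> Ed * bool.
Let E k i := (p k i).1.
Let S k i := ept (p k i).1 (p k i).2.
Hypothesis p_cycle : forall k i, ept (p k i).1 (~~ (p k i).2) = S k (ordS i).
Hypothesis p_inj : forall k, injective (S k).
Hypothesis p_cover : forall e, exists k i, E k i = e.
(* An edge e lies on side e and on at most one other pentagon. *)
Variable side : Ed -> 'I_12.
Hypothesis p_two : forall k k' i i', E k i = E k' i' ->
  (k == side (E k i)) = (k' == side (E k i)) -> k = k'.
Hypothesis euler : (#|Ed| < #|V| + 11)%N.
Hypothesis deg3 : forall v, (3 <= #|[pred h : Ed * bool | ept h.1 h.2 == v]|)%N.

Let ordS_neq (i : 'I_5) : ordS i != i.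
Proof. by case: i => [[|[|[|[|[|]]]]] ?]. Qed.

Let ordSS_neq (i : 'I_5) : ordS (ordS i) != i.
Proof. by case: i => [[|[|[|[|[|]]]]] ?]. Qed.

Lemma no_loop e : ept e false != ept e true.
Proof.
have [k [i <-]] := p_cover e; have := ordS_neq i; rewrite -(inj_eq (@p_inj k)) -p_cycle /S /E.
by case: (p k i) => e' [] //=; rewrite eq_sym.
Qed.

(** An edge repeated in the same direction repeats a vertex; in opposite directions, i and j would
    be successors of each other, impossible modulo 5. *)
Lemma pentagon_edge_inj k : injective (E k).
Proof.
move=> i j; have := p_cycle k i; have := p_cycle k j; rewrite /E.
have hi : S k i = ept (p k i).1 (p k i).2 by [].
have hj : S k j = ept (p k j).1 (p k j).2 by [].
move: hi hj; case: (p k i) (p k j) => [e d] [e' d'] /= hi hj cj ci ee.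
subst e'; have [dd|dd] := eqVneq d d'; first by apply: (@p_inj k); rewrite hi hj dd.
have dE : d' = ~~ d by move: dd; case: (d) (d') => [] [].
have i_j : ordS i = j by apply: (@p_inj k); rewrite -[RHS]/(S k j) hj dE ci.
have j_i : ordS j = i by apply: (@p_inj k); rewrite -[RHS]/(S k i) hi -cj dE negbK.
by have := ordSS_neq i; rewrite i_j j_i eqxx.
Qed.

(** Sends each of the 60 incidences of a pentagon and an edge to the edge and one bit; its
    injectivity gives 60 <= 2 E. *)
Let flag_side (x : 'I_12 * 'I_5) := (E x.1 x.2, x.1 == side (E x.1 x.2)).

Lemma flag_side_inj : injective flag_side.
Proof.
move=> [k i] [k' i'] [] /= ee ss; have kk : k = k' by apply: (p_two ee); rewrite ss ee.
by subst k'; congr (_, _); apply: pentagon_edge_inj ee.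
Qed.

Lemma edge_card_ge : (30 <= #|Ed|)%N.
Proof.
have := leq_card _ flag_side_inj; rewrite !card_prod card_bool !card_ord; lia.
Qed.

Lemma degree_sum : (\sum_v #|[pred h : Ed * bool | ept h.1 h.2 == v]| = #|Ed| * 2)%N.
Proof.
rewrite -card_bool -card_prod -sum1_card (partition_big (fun h => ept h.1 h.2) xpredT)//=.
by apply: eq_bigr => v _; rewrite sum1_card.
Qed.

(** E <= V + 10 and 3 V <= 2 E give E <= 30, and then V = 20. *)
Lemma edge_vertex_card : #|Ed| = 30 /\ #|V| = 20.
Proof.
have : (#|V| * 3 <= #|Ed| * 2)%N.
  rewrite -degree_sum -sum_nat_const; apply: leq_sum => v _; exact: deg3.
have := edge_card_ge; have := euler; lia.
Qed.

Lemma degree3 v : #|[pred h : Ed * bool | ept h.1 h.2 == v]| = 3.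
Proof.
apply/eqP; rewrite eqn_leq deg3 andbT leqNgt; apply/negP => v4.
have [E30 V20] := edge_vertex_card.
have := degree_sum; rewrite E30 (bigD1 v)//=.
have : (\sum_(w | w != v) 3 <=
    \sum_(w | w != v) #|[pred h : Ed * bool | ept h.1 h.2 == w]|)%N.
  by apply: leq_sum => w _; exact: deg3.
rewrite sum_nat_const; have -> : #|[pred w | w != v]| = 19.
  by have := cardC1 v; rewrite V20.
by lia.
Qed.

(** The injection [flag_side] is now between sets of 60 elements. *)
Lemma flag_side_surj e b : exists k i, E k i = e /\ (k == side e) = b.
Proof.
have [E30 _] := edge_vertex_card.
have := inj_card_onto flag_side_inj; rewrite !card_prod card_bool !card_ord E30.
move=> /(_ erefl (e, b)) /codomP[[k i] [ek bk]]; exists k, i.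
by rewrite ek bk.
Qed.

(** * Tiles around an edge and around a vertex *)

Definition on k e := exists i, E k i = e.

Lemma other_face k e : exists2 k', k' != k & on k' e.
Proof.
have [k1 [i1 [e1 s1]]] := flag_side_surj e (k != side e).
exists k1; last by exists i1.
by apply/eqP => kk; move: s1; rewrite kk; case: eqP.
Qed.

Lemma on_two k k1 k2 e : on k e -> on k1 e -> on k2 e -> k1 != k -> k2 != k -> k1 = k2.
Proof.
move=> [i ei] [i1 e1] [i2 e2] k1k k2k.
have two j j' l l' : E j l = e -> E j' l' = e -> (j == side e) = (j' == side e) -> j = j'.
  by move=> h h' s; apply: (p_two (i := l) (i' := l')); rewrite h ?h'.
apply: (two _ _ _ _ e1 e2); case: eqP => [h1|h1]; case: eqP => [h2|h2] //.
- have := two k k2 i i2 ei e2; rewrite (negPf (introN eqP h2)).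
  by case: eqP => [h|_ /(_ erefl) h]; [rewrite h1 h eqxx in k1k|rewrite h eqxx in k2k].
- have := two k k1 i i1 ei e1; rewrite (negPf (introN eqP h1)).
  by case: eqP => [h|_ /(_ erefl) h]; [rewrite h2 h eqxx in k2k|rewrite h eqxx in k1k].
Qed.

(** Symmetric in x and y, so that the direction in which a pentagon is listed does not matter. *)
Definition corner k v x y := exists i, v = S k (ordS i) /\
  (x = E k i /\ y = E k (ordS i) \/ x = E k (ordS i) /\ y = E k i).

Lemma corner_sym k v x y : corner k v x y -> corner k v y x.
Proof. by move=> [i [-> [[-> ->]|[-> ->]]]]; exists i; split => //; [right|left]. Qed.

Lemma corner_next k i : corner k (S k (ordS i)) (E k i) (E k (ordS i)).
Proof. by exists i; split => //; left. Qed.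

Lemma corner_prev k i : corner k (S k i) (E k i) (E k (ord_pred i)).
Proof. by exists (ord_pred i); rewrite ord_predK; split => //; right. Qed.

Lemma cornerP k v x y : corner k v x y -> exists i, x = E k i /\
  (v = S k i /\ y = E k (ord_pred i) \/ v = S k (ordS i) /\ y = E k (ordS i)).
Proof.
move=> [i [-> [[-> ->]|[-> ->]]]]; first by exists i; split => //; right.
by exists (ordS i); rewrite ordSK; split => //; left.
Qed.

Lemma corner_on k v x y : corner k v x y -> on k x.
Proof. by move=> /cornerP[i [-> _]]; exists i. Qed.

Lemma corner_neq k v x y : corner k v x y -> x != y.
Proof.
move=> [i [_ [[-> ->]|[-> ->]]]]; rewrite (inj_eq (@pentagon_edge_inj k)) ?ordS_neq//.
by rewrite eq_sym ordS_neq.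
Qed.

Definition inc v e := exists d, ept e d = v.

Lemma corner_inc k v x y : corner k v x y -> inc v x.
Proof.
move=> /cornerP[i [-> [[-> _]|[-> _]]]]; first by exists (p k i).2.
by exists (~~ (p k i).2); rewrite p_cycle.
Qed.

Lemma on_corner k v x : on k x -> inc v x -> exists y, corner k v x y.
Proof.
move=> [i <-] [d <-]; have [->|dd] := eqVneq d (p k i).2.
  by exists (E k (ord_pred i)); exact: corner_prev.
exists (E k (ordS i)); have -> : d = ~~ (p k i).2.
  by move: dd; case: d (p k i).2 => [] [].
by rewrite p_cycle; exact: corner_next.
Qed.

Lemma corner_uniq k v x y x' y' : corner k v x y -> corner k v x' y' ->
  x' = x /\ y' = y \/ x' = y /\ y' = x.
Proof.
move=> [i [-> h]] [j [/p_inj/ordS_inj ij h']]; subst j.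
by move: h h' => [[-> ->]|[-> ->]] [[-> ->]|[-> ->]]; [left|right|right|left].
Qed.

Lemma corner_two k v v' x y y' : corner k v x y -> corner k v' x y' -> v != v' ->
  exists i, x = E k i /\ (y = E k (ord_pred i) /\ y' = E k (ordS i) \/
                          y = E k (ordS i) /\ y' = E k (ord_pred i)).
Proof.
move=> /cornerP[i [-> h]] /cornerP[j [/pentagon_edge_inj ij h']] vv'; subst j.
exists i; split => //; move: h h' vv' => [[-> ->]|[-> ->]] [[-> ->]|[-> ->]]; rewrite ?eqxx//.
  by left.
by right.
Qed.

(** In the absence of loops, the three edge ends at v belong to distinct edges. *)
Lemma third_edge v x y : inc v x -> inc v y -> x != y ->
  exists z, [/\ inc v z, z != x, z != y & forall w, inc v w -> [\/ w = x, w = y | w = z]].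
Proof.
move=> ix iy xy.
pose I := [set e | [exists d, ept e d == v]]%SET.
have incI e : reflect (inc v e) (e \in I).
  rewrite inE; apply: (iffP existsP) => [[d /eqP h]|[d h]]; exists d => //.
  exact/eqP.
have I3 : #|I| = 3.
  rewrite -(degree3 v) -(card_in_image (f := fst)) => [|[e d] [e' d']].
    apply: eq_card => e; apply/incI/fintype.imageP => [[d h]|[[e' d] h /= ->]].
      by exists (e, d) => //; rewrite inE h.
    by exists d; apply/eqP; rewrite inE in h.
  rewrite !inE /= => /eqP h /eqP h' ee; subst e'.
  have := no_loop e; case: d d' h h' => [] [] // -> ->; by rewrite eqxx.
have : #|I :\ x :\ y| = 1.
  have xI : x \in I by exact/incI.
  have yI : y \in I :\ x by rewrite !inE eq_sym xy; move/incI: iy; rewrite inE.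
  by have := cardsD1 x I; rewrite xI I3 (cardsD1 y (I :\ x)) yI => -[].
move=> /eqP/cards1P[z Iz].
have : z \in I :\ x :\ y by rewrite Iz !inE.
rewrite !in_setD1 => /and3P[zy zx /incI iz]; exists z; split => // w /incI iw.
have [->|wx] := eqVneq w x; first exact: Or31.
have [->|wy] := eqVneq w y; first exact: Or32.
apply: Or33; apply/eqP; have : w \in I :\ x :\ y by rewrite !in_setD1 wx wy iw.
by rewrite Iz !inE.
Qed.

(** If the tile across x had the corner x, y at v as well, it and [k] would be the only tiles on x
    and on y; a tile on z has a corner at v formed by z with x or y, so it would be one of these
    two, whose only corner at v omits z. *)
Lemma third_corner k v x y : corner k v x y -> exists z k1 k2,
  [/\ z != x /\ z != y, k1 != k, k2 != k, corner k1 v x z & corner k2 v y z].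
Proof.
move=> kxy; have kyx := corner_sym kxy.
have [z [iz zx zy zw]] := third_edge (corner_inc kxy) (corner_inc kyx) (corner_neq kxy).
have half x1 y1 : corner k v x1 y1 -> [/\ z != x1, z != y1 &
    forall w, inc v w -> [\/ w = x1, w = y1 | w = z]] ->
    exists2 k1, k1 != k & corner k1 v x1 z.
  move=> c1 [zx1 zy1 zw1].
  have [k1 k1k ok1] := other_face k x1.
  have [y' c'] := on_corner ok1 (corner_inc c1).
  exists k1 => //; have [e|e|<-//] := zw1 _ (corner_inc (corner_sym c')).
    by have := corner_neq c'; rewrite e eqxx.
  subst y'; have [m _ om] := other_face k z.
  have [w cw] := on_corner om iz.
  have absurd j : corner j v x1 y1 -> m = j -> False.
    move=> cj mj; subst j; have [[h _]|[h _]] := corner_uniq cj cw.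
      by rewrite h eqxx in zx1.
    by rewrite h eqxx in zy1.
  have c1' := corner_sym c1; have c'' := corner_sym c'.
  have mx t : corner m v z t -> on k t -> on k1 t -> False.
    move=> ct okt ok1t; have [mk|mk] := eqVneq m k; first exact: (absurd k c1 mk).
    apply: (absurd k1 c').
    exact: (on_two okt (corner_on (corner_sym ct)) ok1t mk k1k).
  have [wE|wE|wE] := zw1 _ (corner_inc (corner_sym cw)).
  - by subst w; case: (mx _ cw (corner_on c1) (corner_on c')).
  - by subst w; case: (mx _ cw (corner_on c1') (corner_on c'')).
  - by have := corner_neq cw; rewrite wE eqxx.
have [k1 k1k c1] := half _ _ kxy (And3 zx zy zw).
have zw' w : inc v w -> [\/ w = y, w = x | w = z].
  by move=> /zw[]; [exact: Or32|exact: Or31|exact: Or33].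
have [k2 k2k c2] := half _ _ kyx (And3 zy zx zw').
by exists z, k1, k2.
Qed.

(** * Arrangements of the edge lengths *)

(* The kinds 0, 1, 2 stand for the lengths a, b, c. *)
Variable kd : Ed -> nat.
Let labels k := [seq kd (E k i) | i <- enum 'I_5].
Hypothesis labelsP : forall k, perm_eq (labels k) [:: 0; 0; 0; 1; 2]%N.

Definition adjacent_labels k := exists i j,
  [/\ adjacent_edges i j, kd (E k i) = 1%N & kd (E k j) = 2].

Hypothesis same_arrangement : forall k k', adjacent_labels k -> adjacent_labels k'.

(** Arithmetic on plain numbers, convertible to [ordS] and [ord_pred], lets the enumeration of
    arrangements be computed. *)
Let nxt i := (i.+1 %% 5)%N.
Let prv i := ((i + 5).-1 %% 5)%N.

Let label_at k (i : 'I_5) : nth 0%N (labels k) i = kd (E k i).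
Proof. by rewrite (nth_map i) ?size_enum_ord// nth_ord_enum. Qed.

(* The arrangement of the labels 0, 0, 0, 1, 2 along a pentagon is one of twenty,
   so that its properties are checked by enumeration. *)
Lemma labels_check (Q : (nat -> nat) -> nat -> bool) :
  all (fun s => all (Q (nth 0%N s)) (iota 0 5)) (permutations [:: 0; 0; 0; 1; 2]%N) ->
  forall k (i : 'I_5), Q (nth 0%N (labels k)) i.
Proof.
move=> /allP h k i; have /h/allP : labels k \in permutations [:: 0; 0; 0; 1; 2]%N.
  by rewrite mem_permutations.
by apply; rewrite mem_iota /=.
Qed.

Let adj (f : nat -> nat) := has (fun i => (f i == 1%N) &&
  ((f (nxt i) == 2) || (f (prv i) == 2))) (iota 0 5).

Let adjP k : reflect (adjacent_labels k) (adj (nth 0%N (labels k))).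
Proof.
apply: (iffP hasP) => [[l l5]|[i [j [ij bi cj]]]].
  move: l5; rewrite mem_iota /= => l5; rewrite -[l]/(nat_of_ord (Ordinal l5)) label_at.
  set o := Ordinal l5; rewrite -[nxt o]/(nat_of_ord (ordS o)).
  rewrite -[prv o]/(nat_of_ord (ord_pred o)) !label_at  => /andP[/eqP bi /orP[] /eqP ci].
    by exists o, (ordS o); rewrite /adjacent_edges eqxx.
  by exists o, (ord_pred o); rewrite /adjacent_edges ord_predK eqxx orbT.
exists (nat_of_ord i); first by rewrite mem_iota /=.
rewrite -[nxt i]/(nat_of_ord (ordS i)) -[prv i]/(nat_of_ord (ord_pred i)) !label_at bi eqxx /=.
move: ij => /orP[/eqP <-|/eqP ij]; first by rewrite cj eqxx.
by rewrite ij ordSK cj eqxx orbT.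
Qed.

Lemma label_neq k v x y : corner k v x y -> kd x != 0%N -> kd y != kd x.
Proof.
have chk := @labels_check (fun f i => (f i != 0%N) ==>
  (f (nxt i) != f i) && (f (prv i) != f i)) erefl k.
move=> /cornerP[i [-> h]]; move: (chk i).
rewrite -[nxt i]/(nat_of_ord (ordS i)) -[prv i]/(nat_of_ord (ord_pred i)) !label_at.
by move=> /implyP c /c/andP[? ?]; case: h => [[_ ->]|[_ ->]].
Qed.

Lemma nonadjacent_absurd : ~ adjacent_labels ord0 -> False.
Proof.
move=> na; have {na} nadj k : ~~ adj (nth 0%N (labels k)).
  by apply/adjP => /same_arrangement/na.
(* If 1 and 2 are not adjacent, their neighbours are 0, there are no three consecutive 0, and some 0
   lies between 1 and 2. *)
have chk := labels_check (Q := fun f i => ~~ adj f ==>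
  ((f i != 0%N) ==> (f (nxt i) == 0%N) && (f (prv i) == 0%N)) &&
  ((f i == 0%N) ==> ~~ ((f (nxt i) == 0%N) && (f (prv i) == 0%N))) &&
  has (fun j => (f j == 0%N) && (f (nxt j) != 0%N) && (f (prv j) != 0%N)) (iota 0 5)) erefl.
have {}chk k i : [/\ kd (E k i) != 0%N -> kd (E k (ordS i)) = 0%N /\ kd (E k (ord_pred i)) = 0%N,
    kd (E k i) = 0%N -> ~ (kd (E k (ordS i)) = 0%N /\ kd (E k (ord_pred i)) = 0%N)
  & exists j, [/\ kd (E k j) = 0%N, kd (E k (ordS j)) != 0%N & kd (E k (ord_pred j)) != 0%N]].
  have /implyP/(_ (nadj k)) := chk k i.
  rewrite -[nxt i]/(nat_of_ord (ordS i)) -[prv i]/(nat_of_ord (ord_pred i)) !label_at.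
  move=> /andP[/andP[/implyP h1 /implyP h2] /hasP[j]]; rewrite mem_iota /= => j5.
  set o := Ordinal j5; rewrite -[j]/(nat_of_ord o).
  rewrite -[nxt o]/(nat_of_ord (ordS o)) -[prv o]/(nat_of_ord (ord_pred o)) !label_at.
  move=> /andP[/andP[/eqP h3 h4] h5]; split; last by exists o.
    by move=> /h1/andP[/eqP ? /eqP ?].
  by move=> /eqP/h2/negP h [/eqP e1 /eqP e2]; apply: h; rewrite e1 e2.
have nz k v x y : corner k v x y -> kd x != 0%N -> kd y = 0%N.
  move=> /cornerP[i [-> h]] xi; have [/(_ xi)[? ?] _ _] := chk k i.
  by case: h => [[_ ->]|[_ ->]].
(* The edge i lies between 1 and 2; the third edges z and z' at its ends are adjacent to these in
   other tiles, hence have kind 0. *)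
have [_ _ [i [i0 n0 p0]]] := chk ord0 ord0.
have [z [k1 [k2 [_ k1k k2k c1 c2]]]] := third_corner (corner_prev ord0 i).
have [z' [k1' [k2' [_ k1'k k2'k c1' c2']]]] := third_corner (corner_next ord0 i).
have kk : k1' = k1.
  apply: on_two (corner_on c1') (corner_on c1) k1'k k1k; by exists i.
subst k1'; have SS : S ord0 i != S ord0 (ordS i) by rewrite (inj_eq (@p_inj _)) eq_sym ordS_neq.
(* The tile across edge i has z, this edge and z' in a row, all of kind 0. *)
have [j [xj zz]] := corner_two c1 c1' SS.
have [_ h _] := chk k1 j; apply: h; first by rewrite -xj.
have z0 := nz _ _ _ _ c2 p0; have z'0 := nz _ _ _ _ c2' n0.
by case: zz => [[<- <-]|[<- <-]].
Qed.

Definition middle k x := exists i, [/\ x = E k i, kd (E k i) = 0%N,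
  kd (E k (ordS i)) = 0%N & kd (E k (ord_pred i)) = 0%N].

(** * The case where b and c are adjacent *)

Section Adjacent.
Hypothesis is_adj : adjacent_labels ord0.

Let chkA (Q : (nat -> nat) -> nat -> bool) :
  all (fun s => all (fun i => adj (nth 0%N s) ==> Q (nth 0%N s) i) (iota 0 5))
    (permutations [:: 0; 0; 0; 1; 2]%N) ->
  forall k (i : 'I_5), Q (nth 0%N (labels k)) i.
Proof.
move=> h k i; have := @labels_check (fun f i => adj f ==> Q f i) h k i.
by move/implyP; apply; apply/adjP; exact: (same_arrangement _ is_adj).
Qed.

(** Each of the adjacent edges 1 and 2 has the other on one side and a 0 on the other side. *)
Lemma one_zero_neighbor k v v' x y y' : corner k v x y -> corner k v' x y' ->
  v != v' -> kd x != 0%N -> kd y = 0%N -> kd y' != 0%N.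
Proof.
move=> c c' /(corner_two c c')[i [-> yy]].
have := @chkA (fun f i => (f i != 0%N) ==>
  ((f (nxt i) == 0%N) != (f (prv i) == 0%N))) erefl k i.
rewrite -[nxt i]/(nat_of_ord (ordS i)) -[prv i]/(nat_of_ord (ord_pred i)) !label_at.
move=> /implyP h x0 y0; move: (h x0).
by case: yy => [[yE ->]|[yE ->]]; rewrite yE in y0; rewrite y0 eqxx; case: (kd _ == 0%N).
Qed.

(** A 0 next to a nonzero kind is an end of the run 0, 0, 0. *)
Lemma middle_neighbor k v v' x y y' : corner k v x y -> corner k v' x y' ->
  v != v' -> kd x = 0%N -> kd y != 0%N -> middle k y'.
Proof.
move=> c c' /(corner_two c c')[i [-> yy]] x0 y0.
have := @chkA (fun f i => (f i == 0%N) ==>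
  ((f (nxt i) != 0%N) ==> (f (prv i) == 0%N) && (f (prv (prv i)) == 0%N)) &&
  ((f (prv i) != 0%N) ==> (f (nxt i) == 0%N) && (f (nxt (nxt i)) == 0%N))) erefl k i.
rewrite -[prv (prv i)]/(nat_of_ord (ord_pred (ord_pred i))).
rewrite -[nxt (nxt i)]/(nat_of_ord (ordS (ordS i))).
rewrite -[nxt i]/(nat_of_ord (ordS i)) -[prv i]/(nat_of_ord (ord_pred i)) !label_at x0 eqxx /=.
move=> /andP[/implyP h1 /implyP h2].
case: yy => [[yE ->]|[yE ->]]; rewrite yE in y0.
  by have /andP[/eqP ? /eqP ?] := h2 y0; exists (ordS i); rewrite ordSK.
by have /andP[/eqP ? /eqP ?] := h1 y0; exists (ord_pred i); rewrite ord_predK.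
Qed.

Lemma middle_intro k v v' x y y' : corner k v x y -> corner k v' x y' ->
  v != v' -> kd x = 0%N -> kd y = 0%N -> kd y' = 0%N -> middle k x.
Proof.
move=> c c' /(corner_two c c')[i [-> yy]] x0 y0 y'0.
by exists i; case: yy => [[yE y'E]|[yE y'E]]; rewrite -yE -y'E.
Qed.

Lemma middle_uniq k x y : middle k x -> middle k y -> x = y.
Proof.
move=> [i [-> i0 iS iP]] [j [-> j0 jS jP]].
have := @chkA (fun f i => all (fun j =>
  [&& f i == 0, f (nxt i) == 0, f (prv i) == 0, f j == 0, f (nxt j) == 0 &
  f (prv j) == 0]%N ==> (i == j)) (iota 0 5)) erefl k i.
move=> /allP/(_ (nat_of_ord j)); rewrite mem_iota /= => /(_ (ltn_ord j)).
rewrite -[nxt i]/(nat_of_ord (ordS i)) -[prv i]/(nat_of_ord (ord_pred i)).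
rewrite -[nxt j]/(nat_of_ord (ordS j)) -[prv j]/(nat_of_ord (ord_pred j)) !label_at.
by rewrite i0 iS iP j0 jS jP !eqxx /= => /eqP/val_inj ->.
Qed.

Lemma middle_ex k : exists i, middle k (E k i).
Proof.
have := @chkA (fun f _ => has (fun j =>
  [&& f j == 0, f (nxt j) == 0 & f (prv j) == 0]%N) (iota 0 5)) erefl k ord0.
move=> /hasP[j]; rewrite mem_iota /= => j5.
set o := Ordinal j5; rewrite -[j]/(nat_of_ord o).
rewrite -[nxt o]/(nat_of_ord (ordS o)) -[prv o]/(nat_of_ord (ord_pred o)) !label_at.
by move=> /and3P[/eqP ? /eqP ? /eqP ?]; exists o, o.
Qed.

(** Here x, y, w, u are consecutive in [k]. The third edge z'' between w and u differs in kind from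
    both, so it is 0. In the tile across w, the third edge z' between y and w is then nonzero. In
    the tile across y, z' is next to y, so z on the other side of y is the middle. *)
Lemma middle_chain k v v' v'' x y w u :
  corner k v x y -> corner k v' y w -> corner k v'' w u -> v != v' -> v' != v'' ->
  kd y = 0%N -> kd w != 0%N -> kd u != 0%N -> 
  exists z k1 k2, [/\ z != x /\ z != y, k1 != k, k2 != k, corner k1 v x z &
    corner k2 v y z /\ middle k2 z].
Proof.
move=> cxy cyw cwu vv' v'v'' y0 w0 u0.
have [z [k1 [k2 [zxy k1k k2k c1 c2]]]] := third_corner cxy.
have [z' [k1' [k2' [_ k1'k k2'k c1' c2']]]] := third_corner cyw.
have [z'' [k1'' [k2'' [_ k1''k k2''k c1'' c2'']]]] := third_corner cwu.
have k12 : k1' = k2.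
  exact: on_two (corner_on cyw) (corner_on c1') (corner_on c2) k1'k k2k.
have k12'' : k1'' = k2'.
  exact: on_two (corner_on cwu) (corner_on c1'') (corner_on c2') k1''k k2'k.
subst k1' k1''.
have zw := label_neq c1'' w0; have zu := label_neq c2'' u0.
have uw := label_neq cwu w0.
have kd3 e : (kd e < 3)%N.
  have [j [i <-]] := p_cover e; have : kd (E j i) \in labels j by apply: map_f; rewrite mem_enum.
  rewrite (perm_mem (labelsP j)) !inE.
  by move=> /or4P[||/eqP->|/orP[]] => [/eqP->|/eqP->|//|/eqP->|/eqP->].
have z''0 : kd z'' = 0%N by move: (kd3 z'') (kd3 w) (kd3 u) zw zu uw w0 u0; lia.
rewrite eq_sym in v'v''.
have z'0 := one_zero_neighbor c1'' c2' v'v'' w0 z''0.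
rewrite eq_sym in vv'.
have m := middle_neighbor c1' c2 vv' y0 z'0.
by exists z, k1, k2.
Qed.

(** Reading the pentagon both ways from its middle edge supplies the hypotheses of [middle_chain] at
    both ends of x. *)
Lemma middle_sides k x : middle k x -> exists v v' y y' w w' u u',
  [/\ v != v', corner k v x y, corner k v' x y' &
  (exists v1 v2, [/\ corner k v1 y w, corner k v2 w u, v != v1 /\ v1 != v2,
     kd y = 0%N & kd w != 0%N /\ kd u != 0%N]) /\
  (exists v1 v2, [/\ corner k v1 y' w', corner k v2 w' u', v' != v1 /\ v1 != v2,
     kd y' = 0%N & kd w' != 0%N /\ kd u' != 0%N])].
Proof.
move=> [i [-> i0 iS iP]].
have := @chkA (fun f i => [&& f i == 0, f (nxt i) == 0 & f (prv i) == 0]%N ==>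
  [&& f (nxt (nxt i)) != 0, f (nxt (nxt (nxt i))) != 0,
  f (prv (prv i)) != 0 & f (prv (prv (prv i))) != 0]%N) erefl k i.
rewrite -[prv (prv (prv i))]/(nat_of_ord (ord_pred (ord_pred (ord_pred i)))).
rewrite -[nxt (nxt (nxt i))]/(nat_of_ord (ordS (ordS (ordS i)))).
rewrite -[prv (prv i)]/(nat_of_ord (ord_pred (ord_pred i))).
rewrite -[nxt (nxt i)]/(nat_of_ord (ordS (ordS i))).
rewrite -[nxt i]/(nat_of_ord (ordS i)) -[prv i]/(nat_of_ord (ord_pred i)) !label_at.
rewrite i0 iS iP !eqxx /= => /and4P[h1 h2 h3 h4].
have pS (j : 'I_5) : ord_pred j != j.
  by rewrite eq_sym; have := ordS_neq (ord_pred j); rewrite ord_predK.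
do 2!eexists; exists (E k (ordS i)), (E k (ord_pred i)), (E k (ordS (ordS i))),
  (E k (ord_pred (ord_pred i))), (E k (ordS (ordS (ordS i)))),
  (E k (ord_pred (ord_pred (ord_pred i)))); split.
- by have /negPf := ordS_neq i; rewrite -(inj_eq (@p_inj k)) => /negbT; exact.
- exact: corner_next.
- exact: corner_prev.
split; do 2!eexists; split; try exact: corner_next; try exact: corner_prev; try by [].
  by split; rewrite eq_sym (inj_eq (@p_inj k)) ordS_neq.
by split; rewrite eq_sym (inj_eq (@p_inj k)) pS.
Qed.

(** By [middle_chain] the third edges at both ends of x are middle edges of some tiles, hence of
    kind 0; so x is also the middle in the tile across it. *)
Lemma middle_across k x : middle k x -> exists y z k1 k2 v,
  [/\ k1 != k, k2 != k, z != x & y != x] /\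
  [/\ corner k1 v x z, corner k2 v y z, middle k2 z & middle k1 x].
Proof.
move=> mx; have [v [v' [y [y' [w [w' [u [u' [vv' c c' [H H']]]]]]]]]] := middle_sides mx.
have [v1 [v2 [cyw cwu [vv1 v12] y0 [w0 u0]]]] := H.
have [v1' [v2' [cyw' cwu' [vv1' v12'] y'0 [w'0 u'0]]]] := H'.
have [z [k1 [k2 [[zx zy] k1k k2k c1 [c2 m2]]]]] :=
  middle_chain c cyw cwu vv1 v12 y0 w0 u0.
have [z' [k1' [k2' [_ k1'k k2'k c1' [c2' m2']]]]] :=
  middle_chain c' cyw' cwu' vv1' v12' y'0 w'0 u'0.
have kk : k1' = k1.
  exact: on_two (corner_on c) (corner_on c1') (corner_on c1) k1'k k1k.
subst k1'; exists y, z, k1, k2, v; split.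
  by split => //; rewrite eq_sym (corner_neq c).
split => //; apply: (middle_intro c1 c1' vv').
- by have [i [-> ->]] := mx.
- by have [i [-> ->]] := m2.
- by have [i [-> ->]] := m2'.
Qed.

Lemma middle_other k k' x : middle k x -> on k' x -> k' != k -> middle k' x.
Proof.
move=> mx okx k'k; have [y [z [k1 [k2 [v [[k1k _ _ _] [c1 _ _ m1]]]]]]] := middle_across mx.
have <- // : k1 = k'; apply: on_two (corner_on c1) okx k1k k'k.
by have [i [-> _ _ _]] := mx; exists i.
Qed.

Lemma adjacent_absurd : False.
Proof.
have [i mi] := middle_ex ord0.
have [y [z [k1 [k2 [v [[k1k k2k zx yx] [c1 c2 m2 m1]]]]]]] := middle_across mi.
have k12 : k1 != k2.
  apply/eqP => kk; subst k2; have [[yE _]|[_ h]] := corner_uniq c1 c2.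
    by rewrite yE eqxx in yx.
  by rewrite h eqxx in zx.
(* The tile k1 is the one across z from k2, so z is its middle edge, as is x. *)
have m1z := middle_other m2 (corner_on (corner_sym c1)) k12.
by rewrite (middle_uniq m1z m1) eqxx in zx.
Qed.

End Adjacent.

Lemma pentagons_absurd : False.
Proof.
have [h|h] := pselect (adjacent_labels ord0); first exact: adjacent_absurd.
exact: nonadjacent_absurd.
Qed.

End Pentagons.

(** * Faces and tiles of a tiling by pentagons, and the conclusion *)

Section TilingFaces.
Variables (R : realType) (G : drawn_graph R).
Hypothesis pent : all_tiles_pentagons G.

Lemma face_eq (U U' : set 'rV[R]_3) x : faces G U -> faces G U' -> U x -> U' x -> U = U'.
Proof.
move=> [y _ <-] [y' _ <-] /same_connected_component -> /same_connected_component -> //.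
Qed.

Lemma face_off_skeleton (U : set 'rV[R]_3) x : faces G U -> U x -> ~ skeleton G x.
Proof. by move=> [y _ <-] /connected_component_sub[]. Qed.

(** The boundary of [U'] lies in the skeleton, so a point of [U] in the closure of [U'] is in [U'].
    Hence counting tiles counts faces. *)
Lemma closure_face_inj (U U' : set 'rV[R]_3) :
  faces G U -> faces G U' -> closure U = closure U' -> U = U'.
Proof.
move=> fU fU' UU'; have [x sx xU] := fU.
have Ux : U x by rewrite -xU; exact: connected_component_refl.
have [q [_ _ bd]] := pent fU'.
have [U'x|nU'x] := pselect (U' x); first exact: face_eq fU fU' Ux U'x.
have : (closure U' `\` U') x by split => //; rewrite -UU'; exact: subset_closure.
rewrite bd => -[i _ ix]; case: (face_off_skeleton fU Ux).
by right; exists (q i).1.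
Qed.

Lemma faces_enum n : (tiles G #= `I_n)%card -> exists U : 'I_n -> set 'rV[R]_3,
  [/\ forall k, faces G (U k), forall F, faces G F -> exists k, F = U k & injective U].
Proof.
rewrite card_eq_sym => /card_set_bijP[f [ff fi fs]].
have ex (k : 'I_n) : exists U, faces G U /\ closure U = f k.
  by have [U fU cU] := ff k (ltn_ord k); exists U.
have [U HU] := choice ex; exists U; split.
- by move=> k; have [] := HU k.
- move=> F fF; have [j jn fj] := fs (closure F) (ex_intro2 _ _ F fF erefl).
  exists (Ordinal jn); have [fU cU] := HU (Ordinal jn).
  by apply: closure_face_inj => //; rewrite cU.
- move=> k k' kk; apply: val_inj; apply: fi.
  + by rewrite inE /=.
  + by rewrite inE /=.
  + by have [_ <-] := HU k; have [_ <-] := HU k'; rewrite kk.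
Qed.

End TilingFaces.

Theorem proposition11 (R : realType) :
  ~ exists (G : drawn_graph R) (len : edge G -> R) (a b c : R),
      [/\ spherical_tiling G /\ all_tiles_pentagons G,
          (tiles G #= `I_12)%card,
          (forall e : edge G, 0 < len e) /\ edge_congruent_tiles len,
          [/\ a != b, a != c & b != c]
        & edge_combination len [:: a; a; a; b; c]].
Proof.
move=> [G [len [a [b [c [[[emb _ deg] pent] card12 [_ cong] [ab ac bc] comb]]]]]].
have [U [fU Uf Uinj]] := faces_enum pent card12.
have [p Hp] := choice (fun k => pent _ (fU k)).
have mid_on (e : edge G) : edge_set e (curve e 2^-1).
  by exists 2^-1 => //; rewrite /= in_itv /=; lra.
have mid_closure k i e : (p k i).1 = e -> closure (U k) (curve e 2^-1).
  move=> <-; have [_ _ bd] := Hp k.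
  have : (closure (U k) `\` U k) (curve (p k i).1 2^-1) by rewrite bd; exists i.
  by case.
have sideP (e : edge G) : exists k, closure (U k) (curve e 2^-1) /\ exists U2,
    forall k', closure (U k') (curve e 2^-1) -> k' = k \/ U k' = U2.
  have [U1 [U2 [fU1 cU1 two]]] := edge_two_faces emb e.
  have [k kE] := Uf _ fU1; subst U1; exists k; split => //; exists U2 => k' ck'.
  by have [/Uinj->|->] := two _ (fU k') ck'; [left|right].
have [side Hside] := choice sideP.
have p_cycle k i : endpt (p k i).1 (~~ (p k i).2) = endpt (p k (ordS i)).1 (p k (ordS i)).2.
  by have [h _ _] := Hp k.
have p_inj k : injective (fun i => endpt (p k i).1 (p k i).2) by have [] := Hp k.
have p_cover (e : edge G) : exists k i, (p k i).1 = e.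
  have [ck _] := Hside e; have [_ _ bd] := Hp (side e).
  have : (closure (U (side e)) `\` U (side e)) (curve e 2^-1).
    split => // /(face_off_skeleton (fU _)); apply; right; exists e => //.
  rewrite bd => -[i _ /(midpoint_edge emb) ie].
  by exists (side e), i.
(* Both pentagons have the midpoint of the edge in their closure; if neither is [side e], both faces
   equal U2. *)
have p_two k k' i i' : (p k i).1 = (p k' i').1 ->
    (k == side (p k i).1) = (k' == side (p k i).1) -> k = k'.
  move=> /esym e2; move: (erefl (p k i).1) e2; move: {-1}(p k i).1 => e e1 e2.
  have [_ [U2 two]] := Hside e.
  have [/eqP->|ks] := boolP (k == side e); first by move=> /esym/eqP.
  move=> /esym k's; have [h|h] := two _ (mid_closure _ _ _ e1).
    by rewrite h eqxx in ks.
  have [h'|h'] := two _ (mid_closure _ _ _ e2); first by rewrite h' eqxx in k's.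
  by apply: Uinj; rewrite h h'.
have noloop := no_loop p_cycle p_inj p_cover.
(* Twelve faces mean m = 11; any vertex can serve as the base vertex. *)
have euler : (#|edge G| < #|vertex G| + 11)%N.
  apply: (graph_euler emb (U := U) (endpt (p ord0 ord0).1 false)) => //.
(* On a tile the only remaining length is a, so the default 0 stands for a. *)
pose kd e : nat := if len e == b then 1%N else if len e == c then 2 else 0%N.
have kd1 e : kd e = 1%N <-> len e = b.
  rewrite /kd; case: eqP => [->|nb]; first by split.
  by case: ifP => _; split => // /nb.
have kd2 e : kd e = 2 <-> len e = c.
  rewrite /kd; case: eqP => [->|nb].
    by split => // bcE; rewrite bcE eqxx in bc.
  by case: eqP => [->|nc]; split.
apply: (@pentagons_absurd _ _ _ _ p_cycle p_inj p_cover side p_two euler deg kd).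
- move=> k; have := comb _ _ (fU k) (Hp k).
  move=> /(perm_map (fun x => if x == b then 1%N else if x == c then 2 else 0%N)) /=.
  by rewrite -map_comp (negPf ab) (negPf ac) !eqxx eq_sym (negPf bc).
- move=> k k' [i [j [ij /kd1 bi /kd2 cj]]].
  have [s [sadj slen]] := cong _ _ _ _ (fU k) (fU k') (Hp k) (Hp k').
  by exists (s i), (s j); rewrite sadj; split => //; [apply/kd1|apply/kd2]; rewrite slen.
Qed.
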